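(* Let $M$ be a cactus configuration such that the points of $Q_M$ do not contain a cycle. Then $I_M=\sqrt{I_{\mathcal C(M)}+G_M}$.
   Context: A point-line configuration is a simple matroid of rank at most three on a finite ground set, say $[d]=\{1,\dots,d\}$. Its elements are called points. A line is a maximal dependent subset with at least three elements all of whose three-element subsets are circuits; $\mathcal L_M$ is the set of lines and $\mathcal L_p$ the set of lines containing the point $p$; the degree of $p$ is $|\mathcal L_p|$. $Q_M$ is the set of points of degree at least three. Realizations: $\Gamma_M$ is the set of $\gamma=(\gamma_1,\dots,\gamma_d)\in(\mathbb C^3)^d$ such that for every subset of $[d]$: it is dependent in $M$ if and only if the corresponding vectors $\gamma_i$ are linearly dependent. $V_M$ is the Zariski closure of $\Gamma_M$ and $I_M=I(V_M)\subset\mathbb C[X]$, where $X$ is a $3\times d$ matrix of indeterminates whose $i$-th column is associated with the point $i$. Circuit ideal: $I_{\mathcal C(M)}$ is generated by the brackets $[i,j,k]$ (determinant of columns $i,j,k$ of $X$) for all circuits $\{i,j,k\}$ of size three of $M$. Grassmann-Cayley ideal: let $X_0$ be the set of all brackets $[i,j,k]$ with $\{i,j,k\}$ a circuit of size three of $M$ (a generating set of $I_{\mathcal C(M)}$). Given a polynomial $P$, a point $x\in[d]$, lines $l_1\ne l_2$ in $\mathcal L_x$, and points $p_1,p_2\in l_1$, $p_3,p_4\in l_2$, let $P'$ be obtained from $P$ by replacing column $x$ by the vector $[p_1,p_2,p_3]\,p_4-[p_1,p_2,p_4]\,p_3$ (here $p_3$, $p_4$ outside brackets denote columns of $X$). For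 $j\ge1$, $X_j$ is the union of $X_{j-1}$ and all polynomials $P'$ so obtained from $P\in X_{j-1}$. The ascending chain of ideals $\langle X_0\rangle\subset\langle X_1\rangle\subset\cdots$ stabilizes, and $G_M$ is its stable value. Cycle: a point-line configuration with $n$ lines is a cycle if there are points $p_1,\dots,p_n$ and an ordering $l_1,\dots,l_n$ of its lines such that each $p_i$ lies on precisely two lines, namely $l_i$ and $l_{i+1}$ (with $l_{n+1}=l_1$), and every other point lies on exactly one line. Free gluing: for point-line configurations $M$ on $[d_1]$, $N$ on $[d_2]$ and points $p\in[d_1]$, $q\in[d_2]$, the free gluing $M\amalg_{p,q}N$ is the point-line configuration on the disjoint union of the two ground sets with $p$ and $q$ identified to one point $P$, whose lines are exactly the lines of $M$ and the lines of $N$ (with $p$, $q$ replaced by $P$). Cactus: a connected cactus configuration is a point-line configuration $M$ for which there is a sequence $N_1,\dots,N_k=M$ such that $N_1$ is a single line (i.e. $U_{2,m}$ with $m\ge 3$) or a cycle, and each $N_{i+1}$ is a free gluing of $N_i$ with a line or a cycle. A cactus configuration is a point-line configuration each of whose connected components (restrictions to the classes of the equivalence relation on points generated by lying on a common line) is a connected cactus configuration. A set $Y$ of points of $M$ contains a cycle if there are $k\ge3$, distinct points $x_1,\dots,x_k\in Y$ and distinct lines $l_1,\dots,l_k\in\mathcal L_M$ with $x_i,x_{i+1}\in l_i$ for all $i$ (indices mod $k$). *)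

(* Defs.v *)
From HB Require Import structures.
From mathcomp Require Import all_boot all_order all_algebra.
From mathcomp Require Import complex reals.
From mathcomp Require Import mpoly.

Set Implicit Arguments.
Unset Strict Implicit.
Unset Printing Implicit Defensive.

Import GRing.Theory.

Record matroid (E : finType) := Matroid {
  indep : {set {set E}};
  indep0 : set0 \in indep;
  indepS : forall A B : {set E}, A \subset B -> B \in indep -> A \in indep;
  indep_aug : forall A B : {set E}, A \in indep -> B \in indep ->
    #|A| < #|B| -> exists2 x, x \in B :\: A & x |: A \in indep
}.

Definition dependent (E : finType) (M : matroid E) (A : {set E}) : bool :=
  A \notin indep M.

Definition circuit (E : finType) (M : matroid E) (C : {set E}) : bool :=
  minset (dependent M) C.

Definition rank (E : finType) (M : matroid E) : nat :=
  \max_(A in indep M) #|A|.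

(* No loops and no parallel elements. *)
Definition simple (E : finType) (M : matroid E) : Prop :=
  forall C : {set E}, circuit M C -> 2 < #|C|.

Definition point_line (E : finType) (M : matroid E) : Prop :=
  simple M /\ rank M <= 3.

Definition lines (E : finType) (M : matroid E) : {set {set E}} :=
  [set l | maxset (fun A : {set E} =>
     [&& dependent M A, 3 <= #|A| &
         [forall C : {set E}, (C \subset A) && (#|C| == 3) ==> circuit M C]]) l].

Definition lines_at (E : finType) (M : matroid E) (p : E) : {set {set E}} :=
  [set l in lines M | p \in l].

Definition degree (E : finType) (M : matroid E) (p : E) : nat := #|lines_at M p|.

Definition Qpoints (E : finType) (M : matroid E) : {set E} :=
  [set p | 3 <= degree M p].

(* [ordS i] is the cyclic successor of [i] in ['I_k]. *)
Definition contains_cycle (E : finType) (M : matroid E) (Y : {set E}) : Prop :=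
  exists k : nat, 3 <= k /\
  exists (x : 'I_k -> E) (l : 'I_k -> {set E}),
    [/\ injective x, injective l, forall i, x i \in Y, forall i, l i \in lines M
      & forall i, x i \in l i /\ x (ordS i) \in l i].

Section Restriction.
Variables (E : finType) (M : matroid E) (A : {set E}).
Let T : finType := {x : E | x \in A}.

Definition restr_indep : {set {set T}} := [set B : {set T} | val @: B \in indep M].

Lemma restr_indep0 : set0 \in restr_indep.
Proof. by rewrite inE imset0 indep0. Qed.

Lemma restr_indepS (B C : {set T}) :
  B \subset C -> C \in restr_indep -> B \in restr_indep.
Proof. by move=> sBC; rewrite !inE; apply/indepS/imsetS. Qed.

Lemma restr_indep_aug (B C : {set T}) :
  B \in restr_indep -> C \in restr_indep -> #|B| < #|C| ->
  exists2 x, x \in C :\: B & x |: B \in restr_indep.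
Proof.
rewrite !inE => iB iC ltBC.
have [|x] := indep_aug iB iC; first by rewrite !card_imset //; exact: val_inj.
rewrite inE => /andP[xB /imsetP[y yC xy]] ix; exists y.
  by rewrite inE yC andbT; apply: contra xB => yB; rewrite xy imset_f.
by rewrite inE imsetU1 -xy.
Qed.

Definition restriction : matroid T :=
  Matroid restr_indep0 restr_indepS restr_indep_aug.

End Restriction.

(* The uniform matroid U_{2,m} with m = #|E| >= 3. *)
Definition is_single_line (E : finType) (M : matroid E) : Prop :=
  3 <= #|E| /\ indep M = [set A : {set E} | #|A| <= 2].

Definition is_cycle (E : finType) (M : matroid E) : Prop :=
  point_line M /\
  exists (n : nat) (p : 'I_n -> E) (l : 'I_n -> {set E}),
    [/\ injective p,
        injective l /\ lines M = [set l i | i : 'I_n],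
        forall i, lines_at M (p i) = [set l i; l (ordS i)] /\ degree M (p i) = 2
      & forall x, (forall i, x <> p i) -> degree M x = 1].

(* [K] is, up to relabelling, the free gluing of [M] and [N] along [p] and [q]:
   [f] and [g] are the inclusions of the two ground sets into their disjoint
   union with [p] and [q] identified. *)
Definition is_free_gluing (E1 E2 E : finType) (M : matroid E1) (N : matroid E2)
    (p : E1) (q : E2) (K : matroid E) : Prop :=
  point_line K /\
  exists (f : E1 -> E) (g : E2 -> E),
    [/\ injective f /\ injective g,
        f p = g q,
        forall x y, f x = g y -> x = p /\ y = q,
        forall z, (exists x, z = f x) \/ (exists y, z = g y)
      & lines K = [set f @: (l : {set E1}) | l in lines M]
                  :|: [set g @: (l : {set E2}) | l in lines N]].

Inductive connected_cactus : forall E : finType, matroid E -> Prop :=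
| cactus_line (E : finType) (M : matroid E) :
    is_single_line M -> connected_cactus M
| cactus_cycle (E : finType) (M : matroid E) :
    is_cycle M -> connected_cactus M
| cactus_glue (E1 E2 E : finType) (M : matroid E1) (N : matroid E2)
    (p : E1) (q : E2) (K : matroid E) :
    connected_cactus M -> is_single_line N \/ is_cycle N ->
    is_free_gluing M N p q K -> connected_cactus K.

Definition collinear (E : finType) (M : matroid E) : rel E :=
  fun x y => [exists l in lines M, (x \in l) && (y \in l)].

(* [collinear M] is symmetric, so its reflexive transitive closure [connect] is
   the equivalence relation it generates. *)
Definition component (E : finType) (M : matroid E) (x : E) : {set E} :=
  [set y | connect (collinear M) x y].

Definition cactus (E : finType) (M : matroid E) : Prop :=
  point_line M /\
  forall x : E, connected_cactus (restriction M (component M x)).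

Local Open Scope ring_scope.

Section Ideals.
Variable A : comNzRingType.
Implicit Types I J : A -> Prop.

Definition ideal_gen (S : A -> Prop) : A -> Prop := fun f =>
  exists (n : nat) (a s : 'I_n -> A),
    (forall i, S (s i)) /\ f = \sum_(i < n) a i * s i.

Definition ideal_add I J : A -> Prop := fun f =>
  exists g h, [/\ I g, J h & f = g + h].

Definition radical I : A -> Prop := fun f => exists n : nat, I (f ^+ n.+1).

End Ideals.

(* The coordinate ring of 3 x d matrices is [{mpoly K[3 * d]}]; the variable of
   the entry in row [i] and column [j] has index [mxvec_index i j]. A point of
   (K^3)^d is a 3 x d matrix, whose [j]-th column is the [j]-th vector. *)
Section Varieties.
Variables (K : fieldType) (d : nat).
Local Notation point := 'M[K]_(3, d).
Local Notation poly := {mpoly K[3 * d]}.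

Definition coord_mx : 'M[poly]_(3, d) := \matrix_(i, j) 'X_(mxvec_index i j).

Definition evalmx (f : poly) (g : point) : K := f.@[fun k => mxvec g 0 k].

Definition substmx (f : poly) (Y : 'M[poly]_(3, d)) : poly :=
  f \mPo [tuple mxvec Y 0 k | k < 3 * d].

Definition zero_locus (S : poly -> Prop) : point -> Prop := fun g =>
  forall f, S f -> evalmx f g = 0.

Definition vanishing_ideal (V : point -> Prop) : poly -> Prop := fun f =>
  forall g, V g -> evalmx f g = 0.

Definition zariski_closure (V : point -> Prop) : point -> Prop := fun g =>
  forall S : poly -> Prop,
    (forall h, V h -> zero_locus S h) -> zero_locus S g.

Definition bracket (i j k : 'I_d) : poly :=
  \det (colsub (tnth [tuple i; j; k]) coord_mx).

Variable M : matroid 'I_d.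

Definition realization (g : point) : Prop :=
  forall A : {set 'I_d},
    dependent M A <-> ~~ free [seq col i g | i <- enum A].

Definition matroid_variety : point -> Prop := zariski_closure realization.

Definition matroid_ideal : poly -> Prop := vanishing_ideal matroid_variety.

Definition circuit_brackets : poly -> Prop := fun f =>
  exists i j k : 'I_d,
    [/\ #|[set i; j; k]| = 3, circuit M [set i; j; k] & f = bracket i j k].

Definition circuit_ideal : poly -> Prop := ideal_gen circuit_brackets.

(* [p1,p2,p3] p4 - [p1,p2,p4] p3 *)
Definition gc_vector (p1 p2 p3 p4 : 'I_d) : 'cV[poly]_3 :=
  bracket p1 p2 p3 *: col p4 coord_mx - bracket p1 p2 p4 *: col p3 coord_mx.

Definition replace_col (x : 'I_d) (v : 'cV[poly]_3) : 'M[poly]_(3, d) :=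
  \matrix_(i, j) if j == x then v i 0 else coord_mx i j.

Definition gc_step (X : poly -> Prop) : poly -> Prop := fun f =>
  X f \/
  exists (P : poly) (x : 'I_d) (l1 l2 : {set 'I_d}) (p1 p2 p3 p4 : 'I_d),
    [/\ X P,
        [/\ l1 \in lines_at M x, l2 \in lines_at M x & l1 != l2],
        p1 \in l1 /\ p2 \in l1,
        p3 \in l2 /\ p4 \in l2
      & f = substmx P (replace_col x (gc_vector p1 p2 p3 p4))].

Definition gc_set (j : nat) : poly -> Prop := iter j gc_step circuit_brackets.

(* The ideals generated by the [gc_set j] form an ascending chain in a
   noetherian ring; its stable value consists of the polynomials that belong to
   all members of the chain from some index on. *)
Definition grassmann_cayley_ideal : poly -> Prop := fun f =>
  exists j0 : nat, forall j : nat, (j0 <= j)%N -> ideal_gen (gc_set j) f.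

End Varieties.

(* Main.v *)
Require Import Defs.
From HB Require Import structures.
From mathcomp Require Import all_boot all_order all_algebra.
From mathcomp Require Import complex reals.
From mathcomp Require Import mpoly.
From mathcomp Require boolp classical_sets.
From mathcomp Require Import ring.

(** By the Nullstellensatz it suffices that every common zero [s] of the
    circuit brackets and of all iterated Grassmann-Cayley polynomials lies in
    the Zariski closure of the realizations.

    If [s x = 0] and two lines through [x] span distinct planes in [s], the
    zero column may be replaced by a vector on the intersection of these planes:
    the new configuration is again a common zero, because the Grassmann-Cayley
    polynomials are stable under exactly this substitution. When no such
    replacement is left, the lines through a zero point that span a plane all
    span the same one. The points of degree at least three and the lines form a
    forest, so pruning leaves one can choose planes for the remaining lines and
    nonzero vectors for the remaining zero points: at each step at most two
    linear conditions are imposed on a vector of 3-space. A zero point of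
    degree at most two lies in at most two planes and needs no care. Hence [s]
    is a degeneration, by scaling columns, of a configuration without zero
    columns in which the lines of the matroid are still dependent.

    For a cactus every such configuration is a limit of realizations, by
    induction on the gluings. Lines and cycles are deformed explicitly; a
    polynomial family of matrices glues two deformations along the common point,
    and a generic shear fixing this point removes the coincidences between the
    two parts. Limits are taken along polynomial maps from an affine space,
    where nonempty open conditions are dense. *)

Set Implicit Arguments.
Unset Strict Implicit.
Unset Printing Implicit Defensive.

Import GRing.Theory.
Local Open Scope ring_scope.

(** * Nullstellensatz *)

(** Zero columns are the whole obstacle: every bracket involving a zero column vanishes, so the
    circuit ideal alone also admits zeros in which the planes of the lines through a zero point have
    no common direction, and these are no limits of realizations. The Grassmann-Cayley polynomials
    remember that such a direction exists. Conversely they vanish at realizations, because the meet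
    of the planes of two lines through [x] is a multiple of column [x], so that the substitution
    only rescales this column.

    The forest condition makes the choices of planes and vectors independent of each other: when a
    leaf is put back, it carries one condition of its own and one from its only neighbour, and
    3-space has room for both.

    In the deformations, each unwanted coincidence is excluded separately, by one sample parameter
    at which it does not occur; density of open conditions then excludes all of them at once, so no
    single explicit parameter has to be good. *)

Section PrimeIdeals.
Variable A : comNzRingType.

Definition is_ideal (I : A -> Prop) : Prop :=
  [/\ I 0, forall x y, I x -> I y -> I (x + y) & forall a x, I x -> I (a * x)].

Definition prime_ideal (P : A -> Prop) : Prop :=
  [/\ is_ideal P, ~ P 1 & forall x y, P (x * y) -> P x \/ P y].

Lemma ideal_sum (I : A -> Prop) (J : Type) (r : seq J) (F : J -> A) :
  is_ideal I -> (forall j, I (F j)) -> I (\sum_(j <- r) F j).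
Proof. by move=> [I0 ID _] IF; apply: big_ind. Qed.

Lemma idealB (I : A -> Prop) x y : is_ideal I -> I x -> I y -> I (x - y).
Proof.
by move=> [_ ID IM] Ix Iy; apply: ID => //; rewrite -mulN1r; apply: IM.
Qed.

Lemma idealMl (I : A -> Prop) a x : is_ideal I -> I x -> I (x * a).
Proof. by move=> [_ _ IM] Ix; rewrite mulrC; apply: IM. Qed.

(** An ideal maximal among those that contain [I] and miss every power of [f] is prime. *)
Lemma exists_prime_ideal (I : A -> Prop) (f : A) :
  is_ideal I -> ~ radical I f ->
  exists P : A -> Prop, [/\ prime_ideal P, forall x, I x -> P x & ~ P f].
Proof.
move=> idI If; have [I0 _ IM] := idI.
have nI n : ~ I (f ^+ n).
  move=> In; apply: If; exists n; rewrite exprS; exact: IM.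
pose good (J : A -> Prop) := [/\ is_ideal J, forall x, I x -> J x & forall n, ~ J (f ^+ n)].
pose Q (J : classical_sets.set A) := (forall x, ~ J x) \/ good J.
have [|P [[P0|[idP IP Pf]] Pmax]] := @classical_sets.Zorn_bigcup A Q.
- move=> F FQ Ftot.
  have [[J [FJ [x Jx]]]|FN] := boolp.pselect (exists J, F J /\ exists x, J x); last first.
    left=> x [J FJ Jx]; apply: FN; exists J; split=> //; by exists x.
  have gF K y : F K -> K y -> good K.
    by move=> FK Ky; case: (FQ _ FK) => // /(_ y).
  have [[J0 JD JM] IJ nJ] := gF _ _ FJ Jx.
  right; split; first split.
  + by exists J.
  + move=> y z [K FK Ky] [K' FK' K'z].
    have [[_ KD _] _ _] := gF _ _ FK Ky.
    have [[_ K'D _] _ _] := gF _ _ FK' K'z.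
    case: (Ftot _ _ FK FK') => sK.
      by exists K' => //; apply: K'D => //; apply: sK.
    by exists K => //; apply: KD => //; apply: sK.
  + move=> a y [K FK Ky]; exists K => //.
    by have [[_ _ KM] _ _] := gF _ _ FK Ky; apply: KM.
  + by move=> y Iy; exists J => //; apply: IJ.
  + move=> n [K FK Kf]; have [_ _ /(_ n)] := gF _ _ FK Kf; exact.
- case: (Pmax I); last by right; split.
  split; last by move=> /(_ 0 I0); apply: P0.
  by move=> x Px; case: (P0 x).
exists P; split=> //; last by move=> Pf1; apply: (Pf 1%N).
have [Pz PD PM] := idP.
split=> //; first by move=> P1; apply: (Pf 0%N).
(* By maximality, adjoining an outside element to [P] captures a power of [f]; the product of two
   such relations gives primality. *)
have key x : ~ P x -> exists n p a, P p /\ f ^+ n = p + a * x.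
  move=> Px; apply: boolp.contrapT => hn.
  case: (Pmax (fun z => exists p a, P p /\ z = p + a * x)).
    split=> [z Pz'|sub]; first by exists z, 0; rewrite mul0r addr0.
    by apply: Px; apply: sub; exists 0, 1; rewrite mul1r add0r.
  right; split.
  - split; first by exists 0, 0; rewrite mul0r addr0.
    + move=> y z [p [a [Pp ->]]] [q [b [Pq ->]]].
      exists (p + q), (a + b); split; first exact: PD.
      by rewrite mulrDl addrACA.
    + move=> c y [p [a [Pp ->]]]; exists (c * p), (c * a); split; first exact: PM.
      by rewrite mulrDr mulrA.
  - by move=> y Iy; exists y, 0; rewrite mul0r addr0; split=> //; apply: IP.
  - by move=> n [p [a [Pp e]]]; apply: hn; exists n, p, a.
move=> x y Pxy; apply: boolp.contrapT => /boolp.not_orP[/key[n [p [a [Pp e]]]]].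
move=> /key[m [q [b [Pq e']]]]; apply: (Pf (n + m)%N).
rewrite exprD e e' mulrDr; apply: (PD); first exact: PM.
rewrite mulrDl; apply: PD; first by apply: idealMl.
by rewrite mulrACA; apply: PM.
Qed.

End PrimeIdeals.

(** * Zeros of prime ideals: adding one variable *)

Section PolyExtension.
Variables (A : idomainType) (k : closedFieldType) (Phi : {rmorphism A -> k} -> Prop).

(** [Phi] records the kind of morphism obtained; the induction on the number of variables takes
    evaluations for it. *)
Hypothesis pointsA : forall (P : A -> Prop) u, prime_ideal P -> ~ P u ->
  exists phi : {rmorphism A -> k},
    [/\ Phi phi, forall x, P x -> phi x = 0 & phi u != 0].

Variables (P : {poly A} -> Prop).
Hypothesis prP : prime_ideal P.

Let p0 (a : A) := P a%:P.

Let idP : is_ideal P. Proof. by case: prP. Qed.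

Let prime0 : prime_ideal p0.
Proof.
have [[P0 PD PM] P1 PP] := prP; rewrite /p0; split.
- split; first by rewrite polyC0.
    by move=> x y; rewrite polyCD; apply: PD.
  by move=> a x; rewrite polyCM; apply: PM.
- by rewrite polyC1.
- by move=> x y; rewrite polyCM; apply: PP.
Qed.

(** The extension of [p0] to [{poly A}], that is, the kernel of reduction modulo [p0]. For
    polynomials with leading coefficient outside [p0], size measures the degree over the fraction
    field of [A / p0]. *)
Let low (f : {poly A}) := forall i, p0 f`_i.

Let lowP f : low f -> P f.
Proof.
move=> lf; rewrite -[f]coefK poly_def; apply: ideal_sum => // i.
by rewrite -mul_polyC mulrC; have [_ _ PM] := idP; apply: PM; apply: lf.
Qed.

Let low_ideal : is_ideal low.
Proof.
have [[P0 PD PM] _ _] := prime0.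
split=> [i|f g lf lg i|f g lg i]; rewrite ?coef0 // ?coefD.
- exact: PD.
- rewrite coefM; apply: ideal_sum; first by case: prime0.
  by move=> j; apply: PM.
Qed.

Let low_lead f : low f -> p0 (lead_coef f). Proof. exact. Qed.

(* The top coefficients lying in [p0] are discarded. *)
Let strip f : ~ low f ->
  exists g, [/\ low (f - g), (size g <= size f)%N & ~ p0 (lead_coef g)].
Proof.
have [n] := ubnP (size f); elim: n f => // n IH f; rewrite ltnS => szf nlf.
have [pf|npf] := boolp.pselect (p0 (lead_coef f)); last first.
  by exists f; split=> //; rewrite subrr; case: low_ideal.
have [f0|fn0] := eqVneq f 0.
  by case: nlf; rewrite f0; case: low_ideal.
pose h := lead_coef f *: 'X^((size f).-1).
have lh : low h.
  move=> i; rewrite coefZ; have [_ _ pM] : is_ideal p0 by case: prime0.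
  by rewrite mulrC; apply: pM.
have szfh : (size (f - h)%R < size f)%N.
  rewrite -[X in (_ < X)%N]prednK ?size_poly_gt0 // ltnS; apply/leq_sizeP => j hj.
  rewrite coefB coefZ coefXn; case: (eqVneq j) => [->|nj].
    by rewrite mulr1 /lead_coef subrr.
  rewrite mulr0 subr0 nth_default //.
  by rewrite leq_eqVlt eq_sym (negbTE nj) /= in hj; rewrite -[size f]prednK ?size_poly_gt0.
have [|g [lg sg pg]] := IH (f - h) (leq_trans szfh szf).
  move=> lfh; apply: nlf; rewrite -[f](subrK h); by case: low_ideal => _ lD _; apply: lD.
exists g; split=> //; last by apply: leq_trans sg (ltnW szfh).
rewrite -[f](subrK h) addrAC; by case: low_ideal => _ lD _; apply: lD.
Qed.

(** Substitute for a generator of the image of [J] over the fraction field of [A / p0], where every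
    ideal is principal. *)
Let minimal (J : {poly A} -> Prop) : is_ideal J -> (forall f, P f -> J f) ->
  (exists f, J f /\ ~ low f) ->
  exists g, [/\ J g, ~ p0 (lead_coef g) &
    forall f, J f -> (size f < size g)%N -> low f].
Proof.
move=> idJ PJ [f [Jf nlf]].
have [n] := ubnP (size f); elim: n f Jf nlf => // n IH f Jf nlf.
rewrite ltnS => szf; have [g [lg sg pg]] := strip nlf.
have Jg : J g.
  by rewrite -[g](subKr f); apply: idealB => //; apply/PJ/lowP.
have [[h [Jh sh nlh]]|hn] :=
  boolp.pselect (exists h, [/\ J h, (size h < size g)%N & ~ low h]).
  apply: (IH h) => //; apply: leq_trans sh _; exact: leq_trans sg szf.
exists g; split=> // h Jh sh; apply: boolp.contrapT => nlh.
by apply: hn; exists h.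
Qed.

Let low_map (phi : {rmorphism A -> k}) f :
  (forall x, p0 x -> phi x = 0) -> low f -> map_poly phi f = 0.
Proof.
by move=> phi0 lf; apply/polyP => i; rewrite coef_map /= coef0; apply: phi0.
Qed.

Let pexp c n : ~ p0 c -> ~ p0 (c ^+ n).
Proof.
have [_ n1 pp] := prime0; move=> pc; elim: n => [|n IH]; first by rewrite expr0.
by rewrite exprS => /pp[].
Qed.

(* Let [g] (resp. [w]) have minimal size in [P] (resp. in [P + (u)]) among the
   polynomials with leading coefficient outside [p0]. Pseudo-division of [g] by
   [w] forces [w] to be a constant; any root of the image of [g] under a
   morphism that does not kill [w] nor the leading coefficient of [g] is then a
   zero of [P] but not of [u]. *)
Lemma poly_points u : ~ P u ->
  exists (phi : {rmorphism A -> k}) (t : k),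
    [/\ Phi phi, forall f, P f -> (map_poly phi f).[t] = 0
      & (map_poly phi u).[t] != 0].
Proof.
move=> nPu; have [_ p01 pp] := prime0.
(* If [P] contains only low polynomials, every [t] is a zero of its image, and it is enough to avoid
   the roots of the image of [u]. *)
have [[f0 [Pf0 nl0]]|allow] := boolp.pselect (exists f, P f /\ ~ low f); last first.
  have [i pi] : exists i, ~ p0 u`_i.
    by apply: boolp.contrapT => hn; apply/nPu/lowP => i; apply: boolp.contrapT => h;
      apply: hn; exists i.
  have [phi [Pphi phi0 phiu]] := pointsA prime0 pi.
  have /closed_nonrootP[t rt] : map_poly phi u != 0.
    by apply/eqP => /polyP /(_ i) /eqP; rewrite coef_map coef0 /= (negbTE phiu).
  exists phi, t; split=> // f Pf; rewrite low_map ?horner0 //.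
  by apply: boolp.contrapT => nl; apply: allow; exists f.
have [g [Pg pg ming]] := minimal idP (fun f => id) (ex_intro _ f0 (conj Pf0 nl0)).
pose J (f : {poly A}) := exists p b, P p /\ f = p + b * u.
have PJ f : P f -> J f by move=> Pf; exists f, 0; rewrite mul0r addr0.
have [P0 PD PM] := idP.
have idJ : is_ideal J.
  split; first exact: PJ.
    move=> y z [p [a [Pp ->]]] [q [b [Pq ->]]]; exists (p + q), (a + b).
    by split; [exact: PD | rewrite mulrDl addrACA].
  move=> c y [p [a [Pp ->]]]; exists (c * p), (c * a).
  by split; [exact: PM | rewrite mulrDr mulrA].
have Ju : J u by exists 0, 1; rewrite mul1r add0r.
have [w [Jw pw minw]] := minimal idJ PJ (ex_intro _ f0 (conj (PJ _ Pf0) nl0)).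
have nz x : ~ p0 (lead_coef x) -> x != 0.
  by move=> px; apply/eqP => x0; apply: px; rewrite x0 lead_coef0 /p0.
have swg : (size w <= size g)%N.
  rewrite leqNgt; apply/negP => sg; apply: pg; apply/low_lead/minw => //.
  exact: PJ.
have divw f : J f -> exists (q r : {poly A}) n,
    [/\ lead_coef w ^+ n *: f = q * w + r, low r & (size r < size w)%N].
  move=> Jf; exists (Pdiv.Ring.rdivp f w), (Pdiv.Ring.rmodp f w).
  exists (Pdiv.Ring.rscalp f w).
  have e := Pdiv.ComRing.rdivp_eq w f.
  have sr : (size (Pdiv.Ring.rmodp f w) < size w)%N.
    by rewrite Pdiv.Ring.ltn_rmodp; apply: nz.
  split=> //; apply: minw => //.
  have -> : Pdiv.Ring.rmodp f w =
    lead_coef w ^+ Pdiv.Ring.rscalp f w *: f - Pdiv.Ring.rdivp f w * w.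
    by rewrite e [RHS]addrC addKr.
  have [_ _ JM] := idJ.
  by apply: idealB => //; [rewrite -mul_polyC|]; apply: JM.
have PZ c f : ~ p0 c -> P (c *: f) -> P f.
  by rewrite -mul_polyC => pc; have [_ _ PP] := prP => /PP[].
have nPw : ~ P w.
  move=> Pw; have [q [r [n [e lr _]]]] := divw _ Ju; apply: nPu.
  apply: (PZ (lead_coef w ^+ n)); first exact: pexp.
  by rewrite e; apply: PD; [exact: PM | exact: lowP].
(* As [w] is not in [P], the quotient [q] is. Minimality of [g] makes [q] at least as long as [g],
   so [w] can only have size 1. *)
have [q [r [n [e lr sr]]]] := divw _ (PJ _ Pg).
have Pq : P q.
  have : P (q * w).
    have -> : q * w = lead_coef w ^+ n *: g - r by rewrite e addrK.
    by apply: idealB; [| rewrite -mul_polyC; apply: PM | exact: lowP].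
  by have [_ _ PP] := prP => /PP[].
have szZ c (f : {poly A}) : ~ p0 c -> size (c *: f)%R = size f.
  move=> pc; apply: size_scale; apply/eqP => c0; apply: pc; rewrite c0; exact: P0.
have cn := pexp (n := n) pw.
have sgq : (size g <= size q)%N.
  rewrite leqNgt; apply/negP => sq; have lq := ming _ Pq sq.
  suff /low_lead : low (lead_coef w ^+ n *: g).
    by rewrite lead_coefZ => /pp[].
  by rewrite e; have [_ lD lM] := low_ideal; apply: lD => //; rewrite mulrC; apply: lM.
have q0 : q != 0.
  by rewrite -size_poly_gt0; apply: leq_trans sgq; rewrite size_poly_gt0 nz.
have sw : (size w <= 1)%N.
  rewrite leqNgt; apply/negP => sw.
  have sqw : (size g < size (q * w)%R)%N.
    rewrite size_mul ?(nz _ pw) // -(prednK (ltnW sw)) addnS /=.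
    by apply: leq_ltn_trans sgq _; rewrite -addn1 leq_add2l -ltnS prednK // ltnW.
  have : size (lead_coef w ^+ n *: g)%R = size (q * w)%R.
    rewrite e size_polyDl //; apply: leq_trans sr _; apply: leq_trans swg (ltnW sqw).
  by rewrite szZ // => es; rewrite es ltnn in sqw.
have ew : w = (lead_coef w)%:P.
  by rewrite [w in LHS]size1_polyC // /lead_coef; case: (size w) sw => [|[|]].
have [phi [Pphi phi0 phiw]] : exists phi : {rmorphism A -> k},
    [/\ Phi phi, forall x, p0 x -> phi x = 0 & phi (lead_coef w * lead_coef g) != 0].
  by apply: pointsA => // /pp[].
move: phiw; rewrite rmorphM mulf_eq0 negb_or => /andP[phiw phig].
have szg : size (map_poly phi g) = size g by apply: size_map_poly_id0.
have /closed_rootP[t rt] : size (map_poly phi g) != 1%N.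
  rewrite szg; apply/eqP => /eqP/size_poly1P[c _ gc].
  by apply: pg; move: Pg; rewrite gc lead_coefC.
have killP f : P f -> (map_poly phi f).[t] = 0.
  move=> Pf; have e' := Pdiv.ComRing.rdivp_eq g f.
  have lr' : low (Pdiv.Ring.rmodp f g).
    apply: ming; last by rewrite Pdiv.Ring.ltn_rmodp nz.
    have -> : Pdiv.Ring.rmodp f g =
      lead_coef g ^+ Pdiv.Ring.rscalp f g *: f - Pdiv.Ring.rdivp f g * g.
      by rewrite e' [RHS]addrC addKr.
    by apply: idealB => //; [rewrite -mul_polyC|]; apply: PM.
  move/(congr1 (fun f => (map_poly phi f).[t])): e'.
  rewrite map_polyZ rmorphD rmorphM /= (low_map phi0 lr') addr0 hornerZ hornerM.
  rewrite (rootP rt) mulr0 rmorphXn => /eqP; rewrite mulf_eq0 expf_eq0 (negbTE phig).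
  by rewrite andbF => /eqP.
exists phi, t; split=> //; have [p [b [Pp ep]]] := Jw.
apply/eqP => u0; move: phiw.
have <- : (map_poly phi w).[t] = phi (lead_coef w).
  by rewrite [in LHS]ew map_polyC hornerC.
by rewrite ep rmorphD rmorphM /= hornerD hornerM u0 mulr0 addr0 killP ?eqxx.
Qed.

End PolyExtension.

Lemma mpoly_gen_ind (R : comNzRingType) n (P : {mpoly R[n]} -> Prop) :
  (forall c, P c%:MP) -> (forall i, P 'X_i) ->
  (forall p q, P p -> P q -> P (p + q)) -> (forall p q, P p -> P q -> P (p * q)) ->
  forall p, P p.
Proof.
move=> PC PX PD PM p; elim/mpolyind: p => [|c m q _ _ Pq].
  by rewrite -mpolyC0; apply: PC.
apply: (PD) => //; rewrite -mul_mpolyC; apply: (PM) => //.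
have P1 : P 1 by rewrite -mpolyC1; apply: PC.
rewrite mpolyXE_id; apply: (big_ind P) => [//|x y|i _]; first exact: PM.
by elim: (m i) => [|j IH]; rewrite ?expr0 // exprS; apply: PM.
Qed.

(** The polynomial [u] strengthens the induction: adding a variable requires a point that avoids the
    zeros of a product of leading coefficients. *)
Lemma mpoly_prime_points (k : closedFieldType) n (P : {mpoly k[n]} -> Prop) u :
  prime_ideal P -> ~ P u ->
  exists v : 'I_n -> k, (forall f, P f -> f.@[v] = 0) /\ u.@[v] != 0.
Proof.
elim: n P u => [|n IH] P u prP nPu.
  have cst (f : {mpoly k[0]}) : exists c, f = c%:MP.
    elim/mpoly_gen_ind: f => [c|[] //|p q [c ->] [d ->]|p q [c ->] [d ->]].
    - by exists c.
    - by exists (c + d); rewrite mpolyCD.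
    - by exists (c * d); rewrite mpolyCM.
  exists (fun=> 0); have [[P0 PD PM] P1 _] := prP; split.
    move=> f; have [c ->] := cst f; rewrite mevalC => Pc; apply/eqP/negPn/negP => c0.
    by apply: P1; rewrite -mpolyC1 -(mulVf c0) mpolyCM; apply: PM.
  have [c ec] := cst u; move: nPu; rewrite ec mevalC => nPc; apply/eqP => c0.
  by apply: nPc; rewrite c0 mpolyC0.
(* The last variable becomes the indeterminate of a univariate polynomial; [P] is pulled back along
   this surjection. *)
pose sg (q : {poly {mpoly k[n]}}) : {mpoly k[n.+1]} :=
  (map_poly (@mwiden n k) q).['X_ord_max].
have sgD p q : sg (p + q) = sg p + sg q by rewrite /sg rmorphD /= hornerD.
have sgM p q : sg (p * q) = sg p * sg q by rewrite /sg rmorphM /= hornerM.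
have sgC c : sg c%:P = @mwiden n k c by rewrite /sg map_polyC /= hornerC.
have sg_surj f : exists q, sg q = f.
  elim/mpoly_gen_ind: f => [c|i|p q [p' <-] [q' <-]|p q [p' <-] [q' <-]].
  - by exists c%:MP%:P; rewrite sgC mwidenC.
  - have [j ->|->] := unliftP ord_max i; last first.
      by exists 'X; rewrite /sg map_polyX hornerX.
    exists ('X_j)%:P; rewrite sgC mwidenX mnmwiden1; congr 'X__.
    by apply/val_inj; rewrite /= /bump leqNgt ltn_ord.
  - by exists (p' + q').
  - by exists (p' * q').
have [[P0 PD PM] P1 PP] := prP.
pose P' q := P (sg q).
have prP' : prime_ideal P'.
  split; first split.
  - by rewrite /P' -[0]polyC0 sgC mwiden0.
  - by move=> p q; rewrite /P' sgD; apply: PD.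
  - by move=> p q; rewrite /P' sgM; apply: PM.
  - by rewrite /P' -[1]polyC1 sgC mwiden1.
  - by move=> p q; rewrite /P' sgM; apply: PP.
have [u' eu] := sg_surj u.
pose Phi (phi : {rmorphism {mpoly k[n]} -> k}) := exists v, phi =1 meval v.
have [||phi [t [[v ev] killP nz]]] := @poly_points _ k Phi _ P' prP' u'.
- move=> Q w prQ nQ; have [v [vQ vw]] := IH _ _ prQ nQ.
  by exists (meval v); split=> //; exists v.
- by rewrite /P' eu.
pose v' (i : 'I_n.+1) := if unlift ord_max i is Some j then v j else t.
have sgv q : (sg q).@[v'] = (map_poly phi q).[t].
  have mw (c : {mpoly k[n]}) : (@mwiden n k c).@[v'] = c.@[v].
    elim/mpoly_gen_ind: c => [c|i|p r|p r].
    - by rewrite mwidenC !mevalC.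
    - rewrite mwidenX mnmwiden1 !mevalXU /v'.
      have -> : widen_ord (leqnSn n) i = lift ord_max i.
        by apply/val_inj; rewrite /= /bump leqNgt ltn_ord.
      by rewrite liftK.
    - by rewrite mwidenD !mevalD => -> ->.
    - by rewrite mwidenM !mevalM => -> ->.
  elim/poly_ind: q => [|q c IHq]; first by rewrite /sg !rmorph0 !horner0 meval0.
  rewrite sgD sgM sgC mevalD mevalM IHq mw rmorphD rmorphM /= map_polyX map_polyC /=.
  rewrite hornerD hornerM hornerX hornerC ev; congr (_ * _ + _).
  by rewrite /sg map_polyX hornerX mevalXU /v' unlift_none.
exists v'; split; last by rewrite -eu sgv.
move=> f Pf; have [q eq] := sg_surj f; rewrite -eq sgv; apply: killP.
by rewrite /P' eq.
Qed.

Lemma nullstellensatz (k : closedFieldType) n (I : {mpoly k[n]} -> Prop) f :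
  is_ideal I -> (forall v, (forall g, I g -> g.@[v] = 0) -> f.@[v] = 0) ->
  radical I f.
Proof.
move=> idI fv; apply: boolp.contrapT => nr.
have [P [prP IP nPf]] := exists_prime_ideal idI nr.
have [v [vP vf]] := mpoly_prime_points prP nPf.
by move: vf; rewrite fv ?eqxx // => g /IP /vP.
Qed.

(** * Vectors of 3-space *)

Section VectorOperations.
Variable F : fieldType.

(** Triples instead of column matrices, so that vector identities split into coordinates and fall to
    [ring]. *)
Definition vec := (F * F * F)%type.
Implicit Types (u v w x y z : vec) (a b : F).

Definition vc1 v : F := v.1.1.
Definition vc2 v : F := v.1.2.
Definition vc3 v : F := v.2.
Definition vzero : vec := (0, 0, 0).
Definition vadd u v : vec := (vc1 u + vc1 v, vc2 u + vc2 v, vc3 u + vc3 v).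
Definition vscale a v : vec := (a * vc1 v, a * vc2 v, a * vc3 v).
Definition dot u v : F := vc1 u * vc1 v + vc2 u * vc2 v + vc3 u * vc3 v.
Definition cross u v : vec :=
  (vc2 u * vc3 v - vc3 u * vc2 v, vc3 u * vc1 v - vc1 u * vc3 v,
   vc1 u * vc2 v - vc2 u * vc1 v).
Definition det3 u v w : F := dot (cross u v) w.

Definition ve1 : vec := (1, 0, 0).
Definition ve2 : vec := (0, 1, 0).
Definition ve3 : vec := (0, 0, 1).

(** A linear form with value 1 at a nonzero [v]: a division by the first nonzero coordinate. *)
Definition dual v : vec :=
  if vc1 v != 0 then ((vc1 v)^-1, 0, 0)
  else if vc2 v != 0 then (0, (vc2 v)^-1, 0) else (0, 0, (vc3 v)^-1).

End VectorOperations.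

Ltac vunfold := rewrite /det3 /dot /cross /vadd /vscale /vzero /ve1 /ve2 /ve3 /vc1 /vc2 /vc3 /=.
Ltac vring := vunfold; try (congr (_, _, _)); ring.

Section Vectors.
Variable F : fieldType.
Local Notation vec := (vec F).
Local Notation vzero := (vzero F).
Local Notation ve1 := (ve1 F).
Local Notation ve2 := (ve2 F).
Local Notation ve3 := (ve3 F).
Implicit Types (u v w x y z : vec) (a b : F).

Lemma vec_neq0P v : v <> vzero -> [|| vc1 v != 0, vc2 v != 0 | vc3 v != 0].
Proof.
case: v => [[a b] c] v0; rewrite /vc1 /vc2 /vc3 /= -!negb_and; apply/negP.
by move=> /and3P[/eqP a0 /eqP b0 /eqP c0]; apply: v0; rewrite a0 b0 c0.
Qed.

Lemma dual_dot v : v <> vzero -> dot (dual v) v = 1.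
Proof.
move=> /vec_neq0P; rewrite /dual; case: eqVneq => [->|v1] /=.
  case: eqVneq => [->|v2] /=; first by move=> v3; vunfold; rewrite !mul0r !add0r mulVf.
  by move=> _; vunfold; rewrite !mul0r addr0 add0r mulVf.
by move=> _; vunfold; rewrite !mul0r !addr0 mulVf.
Qed.

Lemma dotC u v : dot u v = dot v u. Proof. vring. Qed.
Lemma dot0v v : dot vzero v = 0. Proof. vring. Qed.
Lemma dotv0 v : dot v vzero = 0. Proof. vring. Qed.
Lemma dotDr u v w : dot w (vadd u v) = dot w u + dot w v. Proof. vring. Qed.
Lemma dotZl a u v : dot (vscale a u) v = a * dot u v. Proof. vring. Qed.
Lemma dotZr a u v : dot u (vscale a v) = a * dot u v. Proof. vring. Qed.
Lemma dot_crossl u v : dot u (cross u v) = 0. Proof. vring. Qed.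
Lemma dot_crossr u v : dot v (cross u v) = 0. Proof. vring. Qed.
Lemma crossvv v : cross v v = vzero. Proof. vring. Qed.
Lemma cross0v v : cross vzero v = vzero. Proof. vring. Qed.
Lemma crossv0 v : cross v vzero = vzero. Proof. vring. Qed.
Lemma crossC u v : cross u v = vscale (-1) (cross v u). Proof. vring. Qed.
Lemma crossZl a u v : cross (vscale a u) v = vscale a (cross u v). Proof. vring. Qed.
Lemma crossZr a u v : cross u (vscale a v) = vscale a (cross u v). Proof. vring. Qed.
Lemma vscale0 v : vscale 0 v = vzero. Proof. vring. Qed.
Lemma vscalev0 a : vscale a vzero = vzero. Proof. vring. Qed.
Lemma vscale1 v : vscale 1 v = v.
Proof. by case: v => [[a b] c]; vring. Qed.
Lemma vscaleA a b v : vscale a (vscale b v) = vscale (a * b) v. Proof. vring. Qed.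
Lemma vadd0 v : vadd v vzero = v.
Proof. by case: v => [[a b] c]; vring. Qed.
Lemma v0add v : vadd vzero v = v.
Proof. by case: v => [[a b] c]; vring. Qed.
Lemma vaddNK u v : vadd u (vadd v (vscale (-1) u)) = v.
Proof. by case: u v => [[a b] c] [[a' b'] c']; vring. Qed.
Lemma vsubvv v : vadd v (vscale (-1) v) = vzero.
Proof. by case: v => [[a b] c]; vring. Qed.
Lemma vscaleD a u v : vadd (vscale a u) (vscale a v) = vscale a (vadd u v).
Proof. vring. Qed.
Lemma det3_rot u v w : det3 u v w = det3 v w u. Proof. vring. Qed.
Lemma det3_12 u w : det3 u u w = 0. Proof. vring. Qed.
Lemma det3_23 u w : det3 w u u = 0. Proof. vring. Qed.
Lemma det3_13 u w : det3 u w u = 0. Proof. vring. Qed.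
Lemma det3Z a b c u v w :
  det3 (vscale a u) (vscale b v) (vscale c w) = a * b * c * det3 u v w.
Proof. vring. Qed.
Lemma cross_cross u v w : cross u (cross v w) = vadd (vscale (dot u w) v) (vscale (- dot u v) w).
Proof. vring. Qed.
Lemma det3_base : det3 ve1 ve2 ve3 = 1. Proof. vring. Qed.

Lemma vscale_eq0 a v : vscale a v = vzero -> v <> vzero -> a = 0.
Proof.
move=> e /dual_dot d; rewrite -[a]mulr1 -d -dotZr e; exact: dotv0.
Qed.

Lemma cross_neq0C u v : cross u v <> vzero -> cross v u <> vzero.
Proof. by move=> uv vu; apply: uv; rewrite crossC vu vscalev0. Qed.

Lemma cross_neq0l u v : cross u v <> vzero -> u <> vzero.
Proof. by move=> uv u0; apply: uv; rewrite u0 cross0v. Qed.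

Lemma det3_neq0_cross u v w : det3 u v w <> 0 -> cross u v <> vzero.
Proof. by move=> d c; apply: d; rewrite /det3 c dot0v. Qed.

Lemma ve1_neq0 : ve1 <> vzero.
Proof. by move=> [/eqP]; rewrite oner_eq0. Qed.

(* [cross c (cross d e) = d (c.e) - e (c.d)], so [e] with [e.c = 1] solves the equation. *)
Definition cross_sol c d : vec := cross d (dual c).

Lemma cross_solP c d : c <> vzero -> dot c d = 0 -> cross c (cross_sol c d) = d.
Proof.
move=> c0 cd; rewrite /cross_sol cross_cross dotC dual_dot // cd.
by case: d {cd} => [[d1 d2] d3]; vring.
Qed.

Lemma dot_full v : v <> vzero -> exists w, dot v w = 1.
Proof. by move=> v0; exists (dual v); rewrite dotC dual_dot. Qed.

Lemma det3_full u v : cross u v <> vzero -> exists w, det3 u v w = 1.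
Proof. exact: dot_full. Qed.

Lemma cross_full u : u <> vzero -> exists w, cross u w <> vzero.
Proof.
move=> u0; apply: boolp.contrapT => hn.
have c0 w : cross u w = vzero by apply: boolp.contrapT => h; apply: hn; exists w.
apply: u0; move: (c0 ve1) (c0 ve2); case: u {hn c0} => [[a b] c]; vunfold.
move=> [_ + +] [_ _ +]; rewrite !(mulr0, mulr1, sub0r, subr0) => -> /eqP.
by rewrite oppr_eq0 => /eqP -> ->.
Qed.

Lemma parallel u v : cross u v = vzero -> u <> vzero -> exists a, v = vscale a u.
Proof.
move=> uv u0; exists (dot (dual u) v).
have := cross_cross (dual u) u v; rewrite uv crossv0 dual_dot //.
set d := dot (dual u) v; case: u v {uv u0} @d => [[u1 u2] u3] [[v1 v2] v3] d.
vunfold => -[e1 e2 e3]; congr (_, _, _); apply/eqP; rewrite -subr_eq0; apply/eqP.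
- by rewrite -[LHS]opprK -[RHS]opprK oppr0 e1; ring.
- by rewrite -[LHS]opprK -[RHS]opprK oppr0 e2; ring.
- by rewrite -[LHS]opprK -[RHS]opprK oppr0 e3; ring.
Qed.

Lemma cross_trans u v w : v <> vzero -> cross u v = vzero -> cross v w = vzero -> cross u w = vzero.
Proof.
move=> v0 uv /parallel /(_ v0)[a ->]; by rewrite crossZr uv vscalev0.
Qed.

Lemma perp2 h h' u : cross h h' <> vzero -> dot h u = 0 -> dot h' u = 0 ->
  exists a, u = vscale a (cross h h').
Proof.
move=> hh hu h'u; apply: parallel => //.
have -> : cross (cross h h') u = vscale (-1) (cross u (cross h h')) by rewrite crossC.
by rewrite cross_cross dotC h'u dotC hu !oppr0 !vscale0 vadd0 vscalev0.
Qed.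

(** Two linear conditions never exhaust 3-space. The cross product is a solution if they are
    independent; otherwise one condition implies the other. *)
Lemma exists_perp2 (a b : vec) : exists v, [/\ v <> vzero, dot v a = 0 & dot v b = 0].
Proof.
have perp1 c : exists v, v <> vzero /\ dot v c = 0.
  have [c0|c0] := boolp.pselect (c = vzero).
    by exists ve1; rewrite c0 dotv0; split=> //; exact: ve1_neq0.
  have [w cw] := cross_full c0; exists (cross c w); split=> //.
  by rewrite dotC dot_crossl.
have [ab|ab] := boolp.pselect (cross a b = vzero); last first.
  by exists (cross a b); split=> //; rewrite dotC ?dot_crossl ?dot_crossr.
have [a0|a0] := boolp.pselect (a = vzero).
  by have [v [v0 vb]] := perp1 b; exists v; rewrite a0 dotv0.
have [v [v0 va]] := perp1 a; exists v; split=> //.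
by have [c ->] := parallel ab a0; rewrite dotZr va mulr0.
Qed.

Lemma det3_perp h u v w : h <> vzero -> dot h u = 0 -> dot h v = 0 -> dot h w = 0 ->
  det3 u v w = 0.
Proof.
move=> h0 hu hv hw; have [uv|uv] := boolp.pselect (cross u v = vzero).
  by rewrite /det3 uv dot0v.
have [a ha] : exists a, h = vscale a (cross u v) by apply: perp2; rewrite // dotC.
have a0 : a != 0 by apply/eqP => a0; apply: h0; rewrite ha a0 vscale0.
by move: hw; rewrite ha dotZl -/(det3 u v w) => /eqP; rewrite mulf_eq0 (negbTE a0) => /eqP.
Qed.

Lemma det3_span u v w : cross u v <> vzero -> det3 u v w = 0 ->
  exists a b, w = vadd (vscale a u) (vscale b v).
Proof.
move=> uv d; have [t ut] := dot_full uv.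
(* Cramer's rule against the basis [u, v, t] *)
exists (det3 w v t), (det3 u w t).
have cr : vscale (det3 u v t) w =
    vadd (vadd (vscale (det3 w v t) u) (vscale (det3 u w t) v)) (vscale (det3 u v w) t).
  by vring.
by rewrite -[LHS]vscale1 -ut -/(det3 u v t) cr d vscale0 vadd0.
Qed.

Lemma det3_neq0_full u v : cross u v <> vzero -> exists w, det3 u v w <> 0.
Proof. by move=> /det3_full[w e]; exists w; rewrite e; apply/eqP; rewrite oner_eq0. Qed.

(** In rank two, the normal is recorded as the cross product of two members, because the
    Grassmann-Cayley substitution speaks about such products. In rank at most one, the plane stays
    free up to containing the axis [a]. *)
Lemma rank2_or_rank1 (T : finType) (g : T -> vec) (A : {set T}) :
  (forall x y z : T, x \in A -> y \in A -> z \in A -> det3 (g x) (g y) (g z) = 0) ->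
  (exists h, [/\ h <> vzero, exists x y : T, [/\ x \in A, y \in A & h = cross (g x) (g y)]
     & forall x : T, x \in A -> dot h (g x) = 0])
  \/ exists a : vec, forall x : T, x \in A -> exists c, g x = vscale c a.
Proof.
move=> dA.
have [[x [y [xA yA xy]]]|hn] := boolp.pselect
    (exists x y : T, [/\ x \in A, y \in A & cross (g x) (g y) <> vzero]).
  left; exists (cross (g x) (g y)); split=> //; first by exists x, y.
  by move=> z zA; apply: dA.
right; have [[x [xA x0]]|hn0] := boolp.pselect (exists x : T, x \in A /\ g x <> vzero).
  exists (g x) => y yA; apply: parallel => //.
  by apply: boolp.contrapT => xy; apply: hn; exists x, y.
exists vzero => x xA; exists 0; rewrite vscale0.
by apply: boolp.contrapT => x0; apply: hn0; exists x.
Qed.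

Lemma exists_plane (T : finType) (g : T -> vec) (A : {set T}) :
  (forall x y z : T, x \in A -> y \in A -> z \in A -> det3 (g x) (g y) (g z) = 0) ->
  exists h, h <> vzero /\ forall x : T, x \in A -> dot h (g x) = 0.
Proof.
move=> /rank2_or_rank1[[h [h0 _ hA]]|[a ha]]; first by exists h.
have [v [v0 va _]] := exists_perp2 a a; exists v; split=> // x /ha[c ->].
by rewrite dotZr va mulr0.
Qed.

End Vectors.

(** * Polynomial functions and Zariski closure *)

Section Closure.
Variable F : closedFieldType.
Local Notation vec := (vec F).
Local Notation cfg E := (E -> vec).

(** An inductive closure instead of [mpoly], so that any index type can serve: the parameter spaces
    below are indexed by [bool], [E * option bool] and [nat + E]. *)
Inductive polyfun (E : Type) : (cfg E -> F) -> Prop :=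
| polyfun_const c : polyfun (fun _ => c)
| polyfun_c1 x : polyfun (fun s => vc1 (s x))
| polyfun_c2 x : polyfun (fun s => vc2 (s x))
| polyfun_c3 x : polyfun (fun s => vc3 (s x))
| polyfun_add f g : polyfun f -> polyfun g -> polyfun (fun s => f s + g s)
| polyfun_mul f g : polyfun f -> polyfun g -> polyfun (fun s => f s * g s)
| polyfun_ext f g : f =1 g -> polyfun f -> polyfun g.

Definition polyvec (E : Type) (v : cfg E -> vec) : Prop :=
  [/\ polyfun (fun s => vc1 (v s)), polyfun (fun s => vc2 (v s))
    & polyfun (fun s => vc3 (v s))].

Definition polymap (E E' : Type) (phi : cfg E -> cfg E') : Prop :=
  forall x, polyvec (fun s => phi s x).

Lemma polyfun_opp E (f : cfg E -> F) : polyfun f -> polyfun (fun s => - f s).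
Proof.
move=> pf; apply: polyfun_ext (polyfun_mul (polyfun_const _ (-1)) pf) => s.
by rewrite mulN1r.
Qed.

Lemma polyfun_sub E (f g : cfg E -> F) :
  polyfun f -> polyfun g -> polyfun (fun s => f s - g s).
Proof. by move=> pf pg; apply/polyfun_add/polyfun_opp. Qed.

Lemma polyvec_const E (v : vec) : polyvec (fun _ : cfg E => v).
Proof. by split; apply: polyfun_const. Qed.

Lemma polyvec_coord E (x : E) : polyvec (fun s => s x).
Proof. by split; constructor. Qed.

Lemma polyvec_add E (u v : cfg E -> vec) :
  polyvec u -> polyvec v -> polyvec (fun s => vadd (u s) (v s)).
Proof. by move=> [u1 u2 u3] [v1 v2 v3]; split; apply: polyfun_add. Qed.

Lemma polyvec_scale E a (v : cfg E -> vec) :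
  polyfun a -> polyvec v -> polyvec (fun s => vscale (a s) (v s)).
Proof. by move=> pa [v1 v2 v3]; split; apply: polyfun_mul. Qed.

Lemma polyvec_cross E (u v : cfg E -> vec) :
  polyvec u -> polyvec v -> polyvec (fun s => cross (u s) (v s)).
Proof.
by move=> [u1 u2 u3] [v1 v2 v3]; split; apply: polyfun_sub; apply: polyfun_mul.
Qed.

Lemma polyvec_triple E (f g h : cfg E -> F) :
  polyfun f -> polyfun g -> polyfun h -> polyvec (fun s => (f s, g s, h s)).
Proof. by []. Qed.

Lemma polyfun_dot E (u v : cfg E -> vec) :
  polyvec u -> polyvec v -> polyfun (fun s => dot (u s) (v s)).
Proof.
move=> [u1 u2 u3] [v1 v2 v3].
by apply: polyfun_add; [apply: polyfun_add|]; apply: polyfun_mul.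
Qed.

Lemma polyfun_det3 E (u v w : cfg E -> vec) :
  polyvec u -> polyvec v -> polyvec w -> polyfun (fun s => det3 (u s) (v s) (w s)).
Proof. by move=> pu pv pw; apply/polyfun_dot/pw/polyvec_cross. Qed.

Lemma polyfun_comp E E' (phi : cfg E -> cfg E') f :
  polymap phi -> polyfun f -> polyfun (fun s => f (phi s)).
Proof.
move=> pphi; elim=> [c|x|x|x|{}f g _ pf _ pg|{}f g _ pf _ pg|{}f g fg _ pf].
- exact: polyfun_const.
- by case: (pphi x).
- by case: (pphi x).
- by case: (pphi x).
- exact: polyfun_add.
- exact: polyfun_mul.
- by apply: polyfun_ext pf => s.
Qed.

Lemma polyfun_line E (f : cfg E -> F) (a b : cfg E) : polyfun f ->
  exists p : {poly F}, forall t,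
    f (fun x => vadd (a x) (vscale t (b x))) = p.[t].
Proof.
elim=> [c|x|x|x|{}f g _ [p hp] _ [q hq]|{}f g _ [p hp] _ [q hq]|{}f g fg _ [p hp]].
- by exists c%:P => t; rewrite hornerC.
- by exists ((vc1 (a x))%:P + 'X * (vc1 (b x))%:P) => t; rewrite !hornerE.
- by exists ((vc2 (a x))%:P + 'X * (vc2 (b x))%:P) => t; rewrite !hornerE.
- by exists ((vc3 (a x))%:P + 'X * (vc3 (b x))%:P) => t; rewrite !hornerE.
- by exists (p + q) => t; rewrite hp hq hornerD.
- by exists (p * q) => t; rewrite hp hq hornerM.
- by exists p => t; rewrite -fg hp.
Qed.

(* Restrict to the line through [a] and [b]: univariate polynomials form a domain. *)
Lemma polyfun_mul_eq0 E (f u : cfg E -> F) (a b : cfg E) :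
  polyfun f -> polyfun u -> (forall s, f s * u s = 0) -> u a != 0 -> f b = 0.
Proof.
move=> pf pu fu ua.
pose L t x := vadd (a x) (vscale t (vadd (b x) (vscale (-1) (a x)))).
have [p hp] := polyfun_line a (fun x => vadd (b x) (vscale (-1) (a x))) pf.
have [q hq] := polyfun_line a (fun x => vadd (b x) (vscale (-1) (a x))) pu.
have L0 : L 0 = a by apply: boolp.funext => x; rewrite /L vscale0 vadd0.
have L1 : L 1 = b by apply: boolp.funext => x; rewrite /L vscale1 vaddNK.
have pq0 : p * q = 0.
  apply/eqP; apply/negPn/negP => /closed_nonrootP[t].
  by rewrite /root hornerM -hp -hq fu eqxx.
move/eqP: pq0; rewrite mulf_eq0 => /orP[] /eqP e.
  by have := hp 1; rewrite -/(L 1) L1 e horner0.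
by have := hq 0; rewrite -/(L 0) L0 e horner0 => e0; rewrite e0 eqxx in ua.
Qed.

(* Affine space is irreducible, so such conditions are dense; see [generic_and]. *)
Definition generic E (C : cfg E -> Prop) : Prop :=
  exists u, [/\ polyfun u, exists a, u a != 0 & forall s, u s != 0 -> C s].

Lemma generic_mono E (C D : cfg E -> Prop) :
  (forall s, C s -> D s) -> generic C -> generic D.
Proof. by move=> CD [u [pu ua uC]]; exists u; split=> // s /uC /CD. Qed.

Lemma generic_true E (C : cfg E -> Prop) : (forall s, C s) -> generic C.
Proof.
move=> hC; exists (fun=> 1); split=> //; first exact: polyfun_const.
by exists (fun=> vzero F); apply: oner_neq0.
Qed.

Lemma generic_and E (C D : cfg E -> Prop) :
  generic C -> generic D -> generic (fun s => C s /\ D s).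
Proof.
move=> [u [pu [a ua] uC]] [v [pv [b vb] vD]].
exists (fun s => u s * v s); split; first exact: polyfun_mul.
  apply: boolp.contrapT => hn.
  have uv s : u s * v s = 0.
    by apply/eqP/negPn/negP => h; apply: hn; exists s.
  have vu s : v s * u s = 0 by rewrite mulrC.
  by move: vb; rewrite (polyfun_mul_eq0 b pv pu vu ua) eqxx.
by move=> s; rewrite mulf_eq0 negb_or => /andP[/uC ? /vD ?].
Qed.

Lemma generic_all E (I : finType) (C : I -> cfg E -> Prop) :
  (forall i, generic (C i)) -> generic (fun s => forall i, C i s).
Proof.
move=> gC; suff gS (r : seq I) : generic (fun s => forall i, i \in r -> C i s).
  by apply: generic_mono (gS (enum I)) => s h i; apply: h; rewrite mem_enum.
elim: r => [|i r IH]; first exact: generic_true.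
apply: generic_mono (generic_and (gC i) IH) => s [Ci Cr] j.
by rewrite inE => /orP[/eqP ->|/Cr].
Qed.

Lemma generic_imp E (P : Prop) (C : cfg E -> Prop) :
  (P -> generic C) -> generic (fun s => P -> C s).
Proof.
by have [p|np] := boolp.pselect P => [/(_ p)|_]; [apply: generic_mono | apply: generic_true].
Qed.

Lemma generic_fun E (u : cfg E -> F) (a : cfg E) :
  polyfun u -> u a <> 0 -> generic (fun s => u s <> 0).
Proof.
by move=> pu ua; exists u; split=> //; [exists a; apply/eqP | move=> s /eqP].
Qed.

Lemma generic_vec E (v : cfg E -> vec) (a : cfg E) :
  polyvec v -> v a <> vzero F -> generic (fun s => v s <> vzero F).
Proof.
move=> [p1 p2 p3] /vec_neq0P /or3P[] /eqP va.
- by apply: generic_mono (generic_fun p1 va) => s + e; rewrite e.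
- by apply: generic_mono (generic_fun p2 va) => s + e; rewrite e.
- by apply: generic_mono (generic_fun p3 va) => s + e; rewrite e.
Qed.

Definition cl E (S : cfg E -> Prop) (g : cfg E) : Prop :=
  forall f, polyfun f -> (forall h, S h -> f h = 0) -> f g = 0.

Lemma cl_sub E (S : cfg E -> Prop) g : S g -> cl S g.
Proof. by move=> Sg f _; apply. Qed.

Lemma cl_trans E (S S' : cfg E -> Prop) g :
  cl S g -> (forall h, S h -> cl S' h) -> cl S' g.
Proof. by move=> Sg SS' f pf f0; apply: Sg => // h /SS'; apply. Qed.

Lemma cl_image E E' (S : cfg E -> Prop) (S' : cfg E' -> Prop) phi g :
  polymap phi -> (forall h, S h -> S' (phi h)) -> cl S g -> cl S' (phi g).
Proof.
move=> pphi SS' Sg f pf f0; apply: (Sg (fun s => f (phi s))).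
  exact: polyfun_comp.
by move=> h /SS' /f0.
Qed.

(** If [f] vanishes on [S], then the product of [f] along [phi] with the function [u] of the generic
    condition vanishes everywhere, and [u] can be cancelled. *)
Lemma cl_generic E E' (S : cfg E' -> Prop) (phi : cfg E -> cfg E') s :
  polymap phi -> generic (fun s => S (phi s)) -> cl S (phi s).
Proof.
move=> pphi [u [pu [a ua] uS]] f pf f0.
apply: (polyfun_mul_eq0 s (polyfun_comp pphi pf) pu _ ua) => t.
have [->|/uS/f0 ->] := eqVneq (u t) 0; first by rewrite mulr0.
by rewrite mul0r.
Qed.

(** The product of two closures lies in the closure of the product: one argument is frozen at a
    time. *)
Lemma cl2 E1 E2 (S1 : cfg E1 -> Prop) (S2 : cfg E2 -> Prop) f g1 g2 :
  cl S1 g1 -> cl S2 g2 ->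
  (forall h1, polyfun (f h1)) -> (forall h2, polyfun (f^~ h2)) ->
  (forall h1 h2, S1 h1 -> S2 h2 -> f h1 h2 = 0) -> f g1 g2 = 0.
Proof.
move=> c1 c2 p2 p1 f0; apply: (c1 (f^~ g2)) => // h1 Sh1.
by apply: (c2 (f h1)) => // h2; apply: f0.
Qed.

End Closure.

(** * Realizations and free gluings *)

Section Configurations.
Variable F : closedFieldType.
Local Notation vec := (vec F).
Local Notation vzero := (vzero F).

Definition collinear3 (E : finType) (L : {set {set E}}) (x y z : E) : Prop :=
  exists l, [/\ l \in L, x \in l, y \in l & z \in l].

(** Only the set of lines enters, as this is what gluings describe. Vectors are kept away from zero
    through pairs, hence as soon as there is a second point. *)
Definition realizes (E : finType) (L : {set {set E}}) (g : E -> vec) : Prop :=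
  (forall x y, x <> y -> cross (g x) (g y) <> vzero) /\
  forall x y z, x <> y -> y <> z -> x <> z ->
    (det3 (g x) (g y) (g z) = 0 <-> collinear3 L x y z).

Definition weakly_realizes (E : finType) (L : {set {set E}}) (g : E -> vec) : Prop :=
  forall x y z, collinear3 L x y z -> det3 (g x) (g y) (g z) = 0.

Definition nonzero (E : finType) (g : E -> vec) : Prop := forall x, g x <> vzero.

Definition closable (E : finType) (L : {set {set E}}) : Prop :=
  forall g, weakly_realizes L g -> nonzero g -> cl (realizes L) g.

Lemma collinear3_rot (E : finType) (L : {set {set E}}) x y z :
  collinear3 L x y z -> collinear3 L y z x.
Proof. by move=> [l [lL xl yl zl]]; exists l. Qed.

Lemma real_weak (E : finType) (L : {set {set E}}) g : realizes L g -> weakly_realizes L g.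
Proof.
move=> [_ rg] x y z.
have [<- _|/eqP xy] := eqVneq x y; first by rewrite det3_12.
have [<- _|/eqP yz] := eqVneq y z; first by rewrite det3_23.
have [<- _|/eqP xz] := eqVneq x z; first by rewrite det3_13.
by move/rg; apply.
Qed.

Lemma real_map (E : finType) (L : {set {set E}}) g (A : vec -> vec) c :
  (forall u v w, det3 (A u) (A v) (A w) = c * det3 u v w) -> c <> 0 ->
  realizes L g -> realizes L (fun x => A (g x)).
Proof.
move=> dA /eqP c0 [rp rt]; split=> [x y /rp /det3_full[w e]|x y z xy yz xz].
  apply: (@det3_neq0_cross _ _ _ (A w)); rewrite dA e mulr1; exact/eqP.
by rewrite -rt // dA; split=> [/eqP|->]; rewrite ?mulr0 // mulf_eq0 (negbTE c0) => /eqP.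
Qed.

(** A scalar plus a rank one map, of determinant [a * a * (a + dot e k)]. It serves both for shears
    and for moving the gluing point. *)
Definition vtrans (a : F) (e k u : vec) : vec := vadd (vscale a u) (vscale (dot e u) k).

Lemma det3_vtrans a e k u v w :
  det3 (vtrans a e k u) (vtrans a e k v) (vtrans a e k w) =
  a * a * (a + dot e k) * det3 u v w.
Proof. rewrite /vtrans; vring. Qed.

Lemma polyvec_vtrans E (a : (E -> vec) -> F) (e k u : (E -> vec) -> vec) :
  polyfun a -> polyvec e -> polyvec k -> polyvec u ->
  polyvec (fun s => vtrans (a s) (e s) (k s) (u s)).
Proof.
move=> pa pe pk pu; apply: polyvec_add; apply: polyvec_scale => //.
exact: polyfun_dot.
Qed.

(** The linear form [cross (s true) v] kills [v], so [v] is fixed, and everything moves in the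
    direction [s false]. The two vectors are packed as a configuration on [bool] to serve as
    parameters. *)
Definition shear (v : vec) (s : bool -> vec) (u : vec) : vec :=
  vtrans 1 (cross (s true) v) (s false) u.

Lemma polyvec_shear v u : polyvec (fun s => shear v s u).
Proof.
apply: polyvec_vtrans; [exact: polyfun_const | | exact: polyvec_coord | exact: polyvec_const].
by apply: polyvec_cross; [exact: polyvec_coord | exact: polyvec_const].
Qed.

Lemma shear0 v u : shear v (fun=> vzero) u = u.
Proof. by rewrite /shear /vtrans vscalev0 vadd0 vscale1. Qed.

Lemma shear_fix v s : shear v s v = v.
Proof. by rewrite /shear /vtrans dotC dot_crossr vscale0 vadd0 vscale1. Qed.

Lemma shearE v (s : bool -> vec) u :
  shear v s u = vadd u (vscale (det3 (s true) v u) (s false)).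
Proof. by rewrite /shear /vtrans vscale1. Qed.

Lemma shear_move v u t : cross v u <> vzero -> exists s, shear v s u = t.
Proof.
move=> /det3_full[w e]; exists (fun b => if b then w else vadd t (vscale (-1) u)).
by rewrite shearE /= det3_rot e vscale1 vaddNK.
Qed.

(** Serves to separate one point of the first part from two points of the second. If [v], [y], [z]
    are coplanar, then [z] is a combination of the fixed vector [v] and of [y], and it suffices to
    send [y] off the plane of [x] and [v]. *)
Lemma shear_separate v x y z :
  cross x v <> vzero -> cross y z <> vzero -> cross v y <> vzero ->
  exists s, det3 x (shear v s y) (shear v s z) <> 0.
Proof.
move=> xv yz vy.
have [d0|d0] := boolp.pselect (det3 v y z = 0).
  have [t xvt] := det3_neq0_full xv.
  have [a [b ez]] := det3_span vy d0.
  have a0 : a != 0.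
    apply/eqP => a0; apply: yz; rewrite ez a0 vscale0 v0add crossZr crossvv.
    exact: vscalev0.
  have [s es] := shear_move t vy; exists s; rewrite ez.
  have -> : shear v s (vadd (vscale a v) (vscale b y)) = vadd (vscale a v) (vscale b t).
    by rewrite -es -{2}(shear_fix v s) /shear /vtrans; vring.
  rewrite es; have -> : det3 x t (vadd (vscale a v) (vscale b t)) = - a * det3 x v t by vring.
  by apply/eqP; rewrite mulf_neq0 ?oppr_eq0 //; apply/eqP.
have [dx|dx] := boolp.pselect (det3 x y z = 0); last first.
  by exists (fun=> vzero); rewrite !shear0.
have [xz|xz] := boolp.pselect (cross x z = vzero).
  have xy : cross x y <> vzero.
    move=> xy; apply: yz; have x0 := cross_neq0l xv.
    have [a ->] := parallel xy x0; have [b ->] := parallel xz x0.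
    by rewrite crossZl crossZr crossvv !vscalev0.
  (* With [s true = y] the shear also fixes [y], so only [z] moves. The last case exchanges the
     roles of [y] and [z]. *)
  have [k xyk] := det3_neq0_full xy; exists (fun b => if b then y else k).
  rewrite !shearE /=.
  have -> : det3 x (vadd y (vscale (det3 y v y) k)) (vadd z (vscale (det3 y v z) k)) =
    det3 x y z - det3 v y z * det3 x y k by vring.
  rewrite dx sub0r; apply/eqP; rewrite oppr_eq0 mulf_neq0 //; exact/eqP.
have [k xzk] := det3_neq0_full xz; exists (fun b => if b then z else k).
rewrite !shearE /=.
have -> : det3 x (vadd y (vscale (det3 z v y) k)) (vadd z (vscale (det3 z v z) k)) =
  det3 x y z - det3 v y z * det3 x z k by vring.
rewrite dx sub0r; apply/eqP; rewrite oppr_eq0 mulf_neq0 //; exact/eqP.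
Qed.

(** * Free gluings preserve closability *)

Section Glue.
Variables (E1 E2 E : finType) (L1 : {set {set E1}}) (L2 : {set {set E2}}).
Variables (p : E1) (q : E2) (f : E1 -> E) (g : E2 -> E).
Hypotheses (f_inj : injective f) (g_inj : injective g) (fp : f p = g q).
Hypothesis fg : forall x y, f x = g y -> x = p /\ y = q.
Hypothesis cover : forall z, (exists x, z = f x) \/ (exists y, z = g y).

Let L := [set f @: (l : {set E1}) | l in L1] :|: [set g @: (l : {set E2}) | l in L2].

Definition glue (h1 : E1 -> vec) (h2 : E2 -> vec) (z : E) : vec :=
  if [pick x | f x == z] is Some x then h1 x
  else if [pick y | g y == z] is Some y then h2 y else vzero.

Lemma glue_f h1 h2 x : glue h1 h2 (f x) = h1 x.
Proof.
rewrite /glue; case: pickP => [y /eqP /f_inj ->|/(_ x)] //.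
by rewrite eqxx.
Qed.

Lemma glue_g h1 h2 y : h1 p = h2 q -> glue h1 h2 (g y) = h2 y.
Proof.
move=> hpq; rewrite /glue; case: pickP => [x /eqP /fg [-> ->]|_] //.
case: pickP => [z /eqP /g_inj ->|/(_ y)] //.
by rewrite eqxx.
Qed.

Lemma glue_eta h : glue (fun x => h (f x)) (fun y => h (g y)) = h.
Proof.
apply: boolp.funext => z; have [[x ->]|[y ->]] := cover z; first by rewrite glue_f.
by rewrite glue_g ?fp.
Qed.

Lemma polymap_glue I (h1 : (I -> vec) -> E1 -> vec) (h2 : (I -> vec) -> E2 -> vec) :
  polymap h1 -> polymap h2 -> polymap (fun s => glue (h1 s) (h2 s)).
Proof.
move=> p1 p2 z; rewrite /glue; case: pickP => [x _|_]; first exact: p1.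
case: pickP => [y _|_]; first exact: p2.
exact: polyvec_const.
Qed.

Lemma collinear3_glue_f x y z : collinear3 L1 x y z -> collinear3 L (f x) (f y) (f z).
Proof.
move=> [l [lL xl yl zl]]; exists (f @: l); rewrite !imset_f //; split=> //.
by rewrite inE imset_f.
Qed.

Lemma collinear3_glue_g x y z : collinear3 L2 x y z -> collinear3 L (g x) (g y) (g z).
Proof.
move=> [l [lL xl yl zl]]; exists (g @: l); rewrite !imset_f //; split=> //.
by rewrite inE [X in _ || X]imset_f ?orbT.
Qed.

Lemma weak_glue h1 h2 : h1 p = h2 q -> weakly_realizes L1 h1 -> weakly_realizes L2 h2 -> weakly_realizes L (glue h1 h2).
Proof.
move=> hpq w1 w2 x y z.
move=> [l [/setUP[] /imsetP[l0 lL ->] /imsetP[x' ? ->] /imsetP[y' ? ->] /imsetP[z' ? ->]]].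
  by rewrite !glue_f; apply: w1; exists l0.
by rewrite !glue_g //; apply: w2; exists l0.
Qed.

(** No line of the gluing has points of both parts besides the common one, so every triple contained
    in neither part has to be independent. Triples through the common point are covered by the first
    condition, where [x] or [y] may be [p]. *)
Lemma real_glue h1 h2 : h1 p = h2 q -> realizes L1 h1 -> realizes L2 h2 ->
  (forall x y z, x <> y -> z <> q -> det3 (h1 x) (h1 y) (h2 z) <> 0) ->
  (forall x y z, x <> p -> y <> z -> y <> q -> z <> q -> det3 (h1 x) (h2 y) (h2 z) <> 0) ->
  realizes L (glue h1 h2).
Proof.
move=> hpq r1 r2 d1 d2; have wk := weak_glue hpq (real_weak r1) (real_weak r2).
have gf := glue_f h1 h2; have gg y : glue h1 h2 (g y) = h2 y := glue_g y hpq.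
have cov z : (exists x, z = f x) \/ exists y, z = g y /\ y <> q.
  have [|[y ->]] := cover z; first by left.
  by have [->|/eqP yq] := eqVneq y q; [left; exists p | right; exists y].
have [[rp1 rt1] [rp2 rt2]] := (r1, r2).
have mixed x y : y <> q -> cross (h1 x) (h2 y) <> vzero.
  move=> yq; have [->|/eqP xp] := eqVneq x p.
    by rewrite hpq; apply: rp2; apply/nesym.
  apply: (@det3_neq0_cross _ _ _ (h1 p)).
  by rewrite -det3_rot; apply: d1 => //; apply/nesym.
split=> [x y|x y z].
  case: (cov x) => [[x' ->]|[x' [-> xq]]]; case: (cov y) => [[y' ->]|[y' [-> yq]]] xy.
  - by rewrite !gf; apply: rp1 => e; apply: xy; rewrite e.
  - by rewrite gf gg; apply: mixed.
  - by rewrite gf gg; apply/cross_neq0C/mixed.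
  - by rewrite !gg; apply: rp2 => e; apply: xy; rewrite e.
move=> xy yz xz; split; last by apply: wk.
pose h := glue h1 h2; rewrite -/h.
(* This property is invariant under rotation, so only the distributions fff, ffg, fgg and ggg over
   the two parts need a proof. *)
pose T x y z := x <> y -> y <> z -> x <> z -> det3 (h x) (h y) (h z) = 0 -> collinear3 L x y z.
have Trot x' y' z' : T x' y' z' -> T y' z' x'.
  move=> t ? ? ? d; apply/collinear3_rot/t; try exact/nesym; by rewrite // det3_rot.
have Tfff x' y' z' : T (f x') (f y') (f z').
  move=> nxy nyz nxz; rewrite /h !gf => /rt1 t; apply/collinear3_glue_f/t => e;
  [apply: nxy | apply: nyz | apply: nxz]; by rewrite e.
have Tggg x' y' z' : T (g x') (g y') (g z').
  move=> nxy nyz nxz; rewrite /h !gg => /rt2 t; apply/collinear3_glue_g/t => e;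
  [apply: nxy | apply: nyz | apply: nxz]; by rewrite e.
have Tffg x' y' z' : T (f x') (f y') (g z').
  have [->|/eqP zq] := eqVneq z' q; first by rewrite -fp; apply: Tfff.
  move=> nxy _ _; rewrite /h !gf gg => d; case: (d1 x' y' z') => // e.
  by apply: nxy; rewrite e.
have Tfgg x' y' z' : T (f x') (g y') (g z').
  have [->|/eqP xp] := eqVneq x' p; first by rewrite fp; apply: Tggg.
  have [->|/eqP yq] := eqVneq y' q; first by rewrite -fp; apply: Tffg.
  have [->|/eqP zq] := eqVneq z' q; first by rewrite -fp; apply/Trot/Tffg.
  move=> _ nyz _; rewrite /h gf !gg => d; case: (d2 x' y' z') => // e.
  by apply: nyz; rewrite e.
suff : T x y z by apply.
case: (cover x) => [[x' ->]|[x' ->]]; case: (cover y) => [[y' ->]|[y' ->]];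
case: (cover z) => [[z' ->]|[z' ->]] //.
- exact/Trot/Tffg.
- exact/Trot/Trot/Tffg.
- exact/Trot/Trot/Tfgg.
- exact/Trot/Tfgg.
Qed.

Lemma cl_glue_real h1 h2 : h1 p = h2 q -> realizes L1 h1 -> realizes L2 h2 ->
  cl (realizes L) (glue h1 h2).
Proof.
move=> hpq r1 r2.
pose phi s := glue h1 (fun y => shear (h1 p) s (h2 y)).
have phi0 : phi (fun=> vzero) = glue h1 h2.
  by rewrite /phi; congr glue; apply: boolp.funext => y; rewrite shear0.
rewrite -phi0; apply: cl_generic.
  apply: polymap_glue => x; [exact: polyvec_const | exact: polyvec_shear].
have [[rp1 rt1] [rp2 rt2]] := (r1, r2).
(* The determinant of the shear; where it is nonzero, the sheared second part is still a
   realization. *)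
have gd : generic (fun s => 1 + det3 (s true) (h1 p) (s false) <> 0).
  apply: (@generic_fun _ _ _ (fun=> vzero)).
    apply: polyfun_add; first exact: polyfun_const.
    apply: polyfun_det3; [exact: polyvec_coord|exact: polyvec_const|exact: polyvec_coord].
  by rewrite /det3 cross0v dot0v addr0; apply/eqP; apply: oner_neq0.
have g1 : generic (fun s => forall t : E1 * E1 * E2, t.1.1 <> t.1.2 -> t.2 <> q ->
    det3 (h1 t.1.1) (h1 t.1.2) (shear (h1 p) s (h2 t.2)) <> 0).
  apply: generic_all => -[[x y] z] /=; apply: generic_imp => xy; apply: generic_imp => zq.
  have [t xyt] := det3_neq0_full (rp1 _ _ xy).
  have [|s es] := @shear_move (h1 p) (h2 z) t; first by rewrite hpq; apply/rp2/nesym.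
  apply: (@generic_fun _ _ _ s); last by rewrite es.
  by apply: polyfun_det3; [exact: polyvec_const|exact: polyvec_const|exact: polyvec_shear].
have g2 : generic (fun s => forall t : E1 * E2 * E2, t.1.1 <> p -> t.1.2 <> t.2 ->
    t.1.2 <> q -> t.2 <> q ->
    det3 (h1 t.1.1) (shear (h1 p) s (h2 t.1.2)) (shear (h1 p) s (h2 t.2)) <> 0).
  apply: generic_all => -[[x y] z] /=; apply: generic_imp => xp.
  apply: generic_imp => yz; apply: generic_imp => yq; apply: generic_imp => zq.
  have [||s es] := @shear_separate (h1 p) (h1 x) (h2 y) (h2 z) (rp1 _ _ xp).
  - exact: rp2.
  - by rewrite hpq; apply/rp2/nesym.
  apply: (@generic_fun _ _ _ s) => //.
  by apply: polyfun_det3; [exact: polyvec_const|exact: polyvec_shear|exact: polyvec_shear].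
apply: generic_mono (generic_and gd (generic_and g1 g2)) => s [d [d1 d2]].
apply: real_glue => //; first by rewrite -hpq shear_fix.
- apply: (@real_map _ _ _ (shear (h1 p) s) (1 + det3 (s true) (h1 p) (s false))) => // u v w.
  by rewrite /shear det3_vtrans !mul1r.
- by move=> x y z xy zq; apply: (d1 (x, y, z)).
- by move=> x y z xp yz yq zq; apply: (d2 (x, y, z)).
Qed.

(* The linear map [vtrans (e.h2 q) e (h1 p - h2 q)] sends [h2 q] to
   [(e.h2 q) h1 p], and it is the identity when [h1 p = h2 q] and [e.h1 p = 1]. *)
Lemma closable_glue : closable L1 -> closable L2 -> closable L.
Proof.
move=> c1 c2 g0 wg ng; pose a := g0 (f p).
have a0 : a <> vzero by apply: ng.
pose e := dual a; have ea : dot e a = 1 by apply: dual_dot.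
pose Phi (h1 : E1 -> vec) (h2 : E2 -> vec) := glue
  (fun x => vscale (dot e (h2 q)) (h1 x))
  (fun y => vtrans (dot e (h2 q)) e (vadd (h1 p) (vscale (-1) (h2 q))) (h2 y)).
have Phi0 : Phi (fun x => g0 (f x)) (fun y => g0 (g y)) = g0.
  rewrite -[RHS]glue_eta /Phi -fp -/a ea; congr glue; apply: boolp.funext => x.
    by rewrite vscale1.
  by rewrite /vtrans vscale1 vsubvv vscalev0 vadd0.
have w1 : weakly_realizes L1 (fun x => g0 (f x)).
  by move=> x y z /collinear3_glue_f; apply: wg.
have w2 : weakly_realizes L2 (fun y => g0 (g y)).
  by move=> x y z /collinear3_glue_g; apply: wg.
have cl1 := c1 _ w1 (fun x => ng (f x)).
have cl2' := c2 _ w2 (fun y => ng (g y)).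
move=> fn pfn fn0.
(* Up to multiplicity these two factors make up the determinant of the [vtrans] map, and the first
   one also scales [h1]. Both are 1 at [g0]; multiplying by them discards the pairs at which [Phi]
   is degenerate. *)
suff : fn (Phi (fun x => g0 (f x)) (fun y => g0 (g y))) *
    (dot e (g0 (g q)) * dot e (g0 (f p))) = 0.
  by rewrite Phi0 -fp -/a ea !mulr1.
apply: (cl2 (f := fun h1 h2 => fn (Phi h1 h2) * (dot e (h2 q) * dot e (h1 p))) cl1 cl2').
- move=> h1; apply: polyfun_mul.
    apply: polyfun_comp => //; apply: polymap_glue => x.
      apply: polyvec_scale; last exact: polyvec_const.
      by apply: polyfun_dot; [exact: polyvec_const | exact: polyvec_coord].
    apply: polyvec_vtrans; [|exact: polyvec_const| |exact: polyvec_coord].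
      by apply: polyfun_dot; [exact: polyvec_const | exact: polyvec_coord].
    apply: polyvec_add; first exact: polyvec_const.
    by apply: polyvec_scale; [exact: polyfun_const | exact: polyvec_coord].
  by apply: polyfun_mul; apply: polyfun_dot; try exact: polyvec_const; exact: polyvec_coord.
- move=> h2; apply: polyfun_mul.
    apply: polyfun_comp => //; apply: polymap_glue => x.
      by apply: polyvec_scale; [exact: polyfun_const | exact: polyvec_coord].
    apply: polyvec_vtrans; [exact: polyfun_const|exact: polyvec_const| |exact: polyvec_const].
    by apply: polyvec_add; [exact: polyvec_coord | exact: polyvec_const].
  by apply: polyfun_mul; apply: polyfun_dot; try exact: polyvec_const; exact: polyvec_coord.
move=> h1 h2 r1 r2.
have [->|la] := eqVneq (dot e (h2 q)) 0; first by rewrite mul0r mulr0.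
have [->|mu] := eqVneq (dot e (h1 p)) 0; first by rewrite !mulr0.
suff -> : fn (Phi h1 h2) = 0 by rewrite mul0r.
apply: (cl_glue_real _ _ _) => //.
- by rewrite /vtrans vscaleD vaddNK.
- apply: (@real_map _ _ _ (vscale (dot e (h2 q))) (dot e (h2 q) ^+ 3)) => //.
    by move=> u v w; rewrite det3Z !exprS expr0 mulr1 mulrA.
  by apply/eqP; rewrite expf_neq0.
- apply: (@real_map _ _ _ _ (dot e (h2 q) * dot e (h2 q) * dot e (h1 p))) r2.
    by move=> u v w; rewrite det3_vtrans; congr (_ * _ * _); rewrite dotDr dotZr mulN1r subrKC.
  by apply/eqP; rewrite !mulf_neq0.
Qed.

End Glue.

End Configurations.

(** * Point-line configurations and their components *)

Local Open Scope nat_scope.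
Section MatroidFacts.
Variables (E : finType) (M : matroid E).
Implicit Types (A B C l : {set E}) (x y z : E).

Lemma card3 x y z : x <> y -> y <> z -> x <> z -> #|[set x; y; z]| = 3.
Proof.
move=> /eqP xy /eqP yz /eqP xz.
by rewrite setUC cardsU1 cards2 !inE negb_or eq_sym xz eq_sym yz xy.
Qed.

Lemma card3_distinct x y z : #|[set x; y; z]| = 3 -> [/\ x <> y, y <> z & x <> z].
Proof.
have c2 a b : #|[set a; b] : {set E}| <= 2 by rewrite cards2; case: eqP.
by split=> e; have := c2 x z; have := c2 x y; move: H; rewrite e ?setUid;
  [move=> -> | rewrite -setUA setUid => -> | rewrite setUAC setUid => -> ].
Qed.

Hypothesis plM : point_line M.

Lemma indep_le2 A : #|A| <= 2 -> A \in indep M.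
Proof.
move=> cA; apply: contraT => dA; have [C minC CA] := @minset_exists _ (dependent M) _ dA.
have [simM _] := plM; have := simM C minC.
by rewrite ltnNge (leq_trans (subset_leq_card CA) cA).
Qed.

Lemma indep_card A : A \in indep M -> #|A| <= 3.
Proof.
move=> iA; have [_ rM] := plM; apply: leq_trans rM.
by rewrite /rank (bigD1 A) //= leq_maxl.
Qed.

Lemma dependent3_circuit A : #|A| = 3 -> dependent M A -> circuit M A.
Proof.
move=> cA dA; apply/minsetP; split=> // B dB BA; apply/eqP.
rewrite eqEcard BA cA /= ltnNge; apply/negP => cB.
by move: dB; rewrite /dependent indep_le2.
Qed.

Lemma line_card l : l \in lines M -> 3 <= #|l|.
Proof. by rewrite inE => /maxsetp /and3P[]. Qed.

Lemma line_circuit l C : l \in lines M -> C \subset l -> #|C| = 3 -> circuit M C.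
Proof.
rewrite inE => /maxsetp /and3P[_ _ /forallP /(_ C)] + Cl cC.
by rewrite Cl cC eqxx.
Qed.

Lemma line_dependent l C : l \in lines M -> C \subset l -> #|C| = 3 -> dependent M C.
Proof. by move=> lM Cl cC; have /minsetp := line_circuit lM Cl cC. Qed.

Lemma dependent_collinear3 x y z : x <> y -> y <> z -> x <> z ->
  dependent M [set x; y; z] <-> collinear3 (lines M) x y z.
Proof.
move=> xy yz xz; have c3 := card3 xy yz xz; split=> [dA|[l [lM xl yl zl]]].
  have [|l maxl Al] := @maxset_exists _ (fun A : {set E} =>
     [&& dependent M A, 3 <= #|A| &
         [forall C : {set E}, (C \subset A) && (#|C| == 3) ==> circuit M C]]) [set x; y; z].
    rewrite dA c3 /=; apply/forallP => C; apply/implyP => /andP[CA /eqP cC].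
    have -> : C = [set x; y; z] by apply/eqP; rewrite eqEcard CA c3 cC.
    exact: dependent3_circuit.
  by exists l; rewrite inE maxl !(subsetP Al) // !inE eqxx ?orbT.
by apply: line_dependent c3; [exact: lM | rewrite !subUset !sub1set xl yl zl].
Qed.

(** Every triple in the union of the two lines is dependent: an independent one would augment
    [[set x; y]] by a point of one of the lines. By maximality both lines equal the union. *)
Lemma line_eq l1 l2 x y : l1 \in lines M -> l2 \in lines M -> x <> y ->
  x \in l1 -> y \in l1 -> x \in l2 -> y \in l2 -> l1 = l2.
Proof.
move=> l1M l2M xy x1 y1 x2 y2.
have B3 C : C \subset l1 :|: l2 -> #|C| = 3 -> circuit M C.
  move=> CB cC; apply: dependent3_circuit => //; apply/negP => iC.
  have ixy : [set x; y] \in indep M by apply: indep_le2; rewrite cards2; case: eqP.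
  have [|z /setDP[zC]] := indep_aug ixy iC; first by rewrite cC cards2; case: eqP.
  rewrite !inE negb_or => /andP[/eqP zx /eqP zy]; apply/negP.
  have c3 : #|z |: [set x; y]| = 3 by rewrite setUC card3 // => e; [apply: zy | apply: zx].
  have /setUP[z1|z2] := subsetP CB z zC.
    by apply: line_dependent c3; [exact: l1M | rewrite !subUset !sub1set z1 x1 y1].
  by apply: line_dependent c3; [exact: l2M | rewrite !subUset !sub1set z2 x2 y2].
have pB : [&& dependent M (l1 :|: l2), 3 <= #|l1 :|: l2| &
         [forall C : {set E}, (C \subset l1 :|: l2) && (#|C| == 3) ==> circuit M C]].
  apply/and3P; split.
  - have : dependent M l1 by move: l1M; rewrite inE => /maxsetp /and3P[].
    by apply: contra; apply: indepS; apply: subsetUl.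
  - by apply: leq_trans (line_card l1M) (subset_leq_card (subsetUl _ _)).
  - by apply/forallP => C; apply/implyP => /andP[CB /eqP cC]; apply: B3.
move: l1M l2M; rewrite !inE => /maxsetP[_ m1] /maxsetP[_ m2].
by rewrite -(m1 _ pB (subsetUl _ _)) (m2 _ pB (subsetUr _ _)).
Qed.

End MatroidFacts.

Lemma lines_single (E : finType) (M : matroid E) :
  is_single_line M -> lines M = [set [set: E]].
Proof.
move=> [cE iM].
have pT : [&& dependent M setT, 3 <= #|[set: E]| &
         [forall C : {set E}, (C \subset setT) && (#|C| == 3) ==> circuit M C]].
  rewrite /dependent iM inE cardsT -ltnNge cE /=; apply/forallP => C.
  apply/implyP => /andP[_ /eqP cC]; apply/minsetP.
  rewrite /dependent iM inE cC; split=> // B; rewrite inE -ltnNge => cB BC.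
  by apply/eqP; rewrite eqEcard BC cC.
apply/setP => l; rewrite !inE; apply/idP/eqP => [/maxsetP[_ ml]|->].
  by rewrite (ml _ pT (subsetT _)).
by apply/maxsetP; split=> // B _ TB; apply/eqP; rewrite eqEsubset subsetT.
Qed.

Lemma point_line_restriction (E : finType) (M : matroid E) A :
  point_line M -> point_line (restriction M A).
Proof.
move=> plM; split.
  move=> C /minsetp; rewrite /dependent inE ltnNge; apply: contra => cC.
  by apply: indep_le2 => //; apply: leq_trans (leq_imset_card _ _) cC.
apply/bigmax_leqP => B; rewrite inE => /(indep_card plM).
by rewrite card_imset //; apply: val_inj.
Qed.

(** Both sides say that the triple is dependent, which does not change under restriction. *)
Lemma collinear3_restriction (E : finType) (M : matroid E) (A : {set E})
    (x y z : {x : E | x \in A}) : point_line M -> x <> y -> y <> z -> x <> z ->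
  collinear3 (lines (restriction M A)) x y z <->
  collinear3 (lines M) (val x) (val y) (val z).
Proof.
move=> plM xy yz xz; have plA := point_line_restriction A plM.
have vne (a b : {x : E | x \in A}) : a <> b -> val a <> val b.
  by move=> ab /val_inj.
rewrite -(dependent_collinear3 plA) // -(dependent_collinear3 plM); try exact: vne.
by rewrite /dependent inE !imsetU !imset_set1.
Qed.

Local Open Scope ring_scope.

(** * Disjoint unions of components *)

Section Components.
Variable F : closedFieldType.
Local Notation vec := (vec F).
Local Notation vzero := (vzero F).
Variables (E : finType) (L : {set {set E}}) (c : E -> E) (A : E -> {set E}).
Local Notation T i := ({x : E | x \in A i}).
Variable (L_ : forall i, {set {set T i}}).
Arguments L_ : clear implicits.
Hypothesis mem_A : forall x y, (y \in A (c x)) = (c y == c x).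
Hypothesis L_A : forall i (x y z : T i), x <> y -> y <> z -> x <> z ->
  collinear3 (L_ i) x y z <-> collinear3 L (val x) (val y) (val z).
Hypothesis L_c : forall x y z, collinear3 L x y z -> c x = c y /\ c y = c z.
Hypothesis partner : forall x, exists y, x <> y /\ c x = c y.

Let into i (k : T i -> vec) (h : E -> vec) (x : E) : vec :=
  if insub x is Some t then k t else h x.

Let intoT i k h (t : T i) : into k h (val t) = k t.
Proof. by rewrite /into valK. Qed.

Let intoF i (k : T i -> vec) h x : x \notin A i -> into k h x = h x.
Proof. by move=> xA; rewrite /into insubN. Qed.

Lemma cl_components g :
  (forall x, closable F (L_ (c x))) -> weakly_realizes L g -> nonzero g ->
  cl (fun h => forall x, realizes (F := F) (L_ (c x)) (fun t => h (val t))) g.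
Proof.
move=> clA wg ng.
have clR x : cl (realizes (F := F) (L_ (c x))) (fun t => g (val t)).
  apply: clA => [u v w|t]; last exact: ng.
  have [->|/eqP uv] := eqVneq u v; first by rewrite det3_12.
  have [->|/eqP vw] := eqVneq v w; first by rewrite det3_23.
  have [->|/eqP uw] := eqVneq u w; first by rewrite det3_13.
  by move=> /(L_A uv vw uw) /wg.
(* Components are replaced one at a time: those met by [r] are already realized, and the others
   still agree with [g], so that the closability of the next one applies. *)
pose S (r : seq E) (h : E -> vec) := (forall x, x \in r -> realizes (F := F) (L_ (c x)) (fun t => h (val t))) /\
  forall x, (forall y, y \in r -> c y != c x) -> h x = g x.
suff SP r : cl (S r) g.
  by apply: cl_trans (SP (enum E)) _ => h [Sh _]; apply: cl_sub => x; apply: Sh; rewrite mem_enum.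
elim: r => [|x r IH]; first by apply: cl_sub.
apply: cl_trans IH _ => h [Sh hg].
have [/hasP[y yr /eqP xy]|/hasPn nr] := boolP (has (fun y => c y == c x) r).
  apply: cl_sub; split=> [z|z zr]; last by apply: hg => w wr; apply: zr; rewrite inE wr orbT.
  by rewrite inE => /orP[/eqP ->|/Sh //]; rewrite -xy; apply: Sh.
have eh : h = into (fun t : T (c x) => g (val t)) h.
  apply: boolp.funext => z; rewrite /into; case: insubP => [t tA ->|//].
  by rewrite mem_A in tA; apply: hg => y /nr; rewrite (eqP tA).
rewrite eh; apply: (@cl_image _ _ _ _ _ (fun k => into k h) _ _ _ (clR x)) => [z|k rk].
  rewrite /into; case: insubP => [t _ _|_]; [exact: polyvec_coord | exact: polyvec_const].
split=> [y|y hy]; last first.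
  rewrite intoF ?mem_A; last by rewrite eq_sym; apply: hy; rewrite mem_head.
  by apply: hg => z zr; apply: hy; rewrite inE zr orbT.
rewrite inE; have [exy _|/eqP nxy yr] := eqVneq (c y) (c x).
  by rewrite exy; rewrite (_ : (fun t => _) = k) //; apply: boolp.funext => t; apply: intoT.
have {}yr : y \in r by case/orP: yr => // /eqP e; rewrite e in nxy.
rewrite (_ : (fun t => _) = (fun t => h (val t))); first exact: Sh.
apply: boolp.funext => t; apply: intoF; rewrite mem_A.
by have := valP t; rewrite mem_A => /eqP ->; apply/eqP.
Qed.

Definition vlin (r1 r2 r3 u : vec) : vec := (dot r1 u, dot r2 u, dot r3 u).

Lemma det3_vlin r1 r2 r3 u v w :
  det3 (vlin r1 r2 r3 u) (vlin r1 r2 r3 v) (vlin r1 r2 r3 w) =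
  det3 r1 r2 r3 * det3 u v w.
Proof. rewrite /vlin; vring. Qed.

Lemma vlin_move (u t : vec) : u <> vzero -> exists r1 r2 r3, vlin r1 r2 r3 u = t.
Proof.
move=> u0; exists (vscale (vc1 t) (dual u)), (vscale (vc2 t) (dual u)), (vscale (vc3 t) (dual u)).
rewrite /vlin !dotZl dual_dot // !mulr1; by case: t => [[]].
Qed.

Lemma vlin_id (u : vec) : vlin (ve1 F) (ve2 F) (ve3 F) u = u.
Proof. by case: u => [[u1 u2] u3]; rewrite /vlin; vring. Qed.

(** Each component is moved by its own linear map, with rows indexed by [option bool]. *)
Let phi (h : E -> vec) (s : E * option bool -> vec) (x : E) : vec :=
  vlin (s (c x, None)) (s (c x, Some true)) (s (c x, Some false)) (h x).

Let polymap_phi h : polymap (phi h).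
Proof.
move=> x; apply: polyvec_triple; apply: polyfun_dot;
  by [exact: polyvec_coord | exact: polyvec_const].
Qed.

(** Independent generic linear maps on the components keep the determinants inside a component up to
    a nonzero factor and make all other triples independent. *)
Lemma real_components h : (forall x, realizes (F := F) (L_ (c x)) (fun t => h (val t))) -> cl (realizes L) h.
Proof.
move=> rh.
have same x y z (xA : x \in A (c z)) (yA : y \in A (c z)) (zA : z \in A (c z)) :
    x <> y -> y <> z -> x <> z -> det3 (h x) (h y) (h z) = 0 <-> collinear3 L x y z.
  move=> xy yz xz; have [_ r3] := rh z.
  have ne a b (aA : a \in A (c z)) (bA : b \in A (c z)) : a <> b -> (Sub a aA : T _) <> Sub b bA.
    by move=> ab /(congr1 val) /=.
  rewrite -(L_A (ne _ _ xA yA xy) (ne _ _ yA zA yz) (ne _ _ xA zA xz)).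
  exact: (r3 _ _ _ (ne _ _ xA yA xy) (ne _ _ yA zA yz) (ne _ _ xA zA xz)).
have pairs x y : c x = c y -> x <> y -> cross (h x) (h y) <> vzero.
  move=> cxy xy; have [r2 _] := rh y.
  have xA : x \in A (c y) by rewrite mem_A cxy.
  have yA : y \in A (c y) by rewrite mem_A.
  by apply: (r2 (Sub x xA) (Sub y yA)) => /(congr1 val).
have nh x : h x <> vzero by have [y [xy cxy]] := partner x; apply: cross_neq0l (pairs _ _ cxy xy).
pose s0 (i : E * option bool) : vec :=
  match i.2 with None => ve1 F | Some true => ve2 F | Some false => ve3 F end.
have phi0 : phi h s0 = h by apply: boolp.funext => x; rewrite /phi vlin_id.
rewrite -phi0; apply: cl_generic => //.
have gD : generic (fun s : E * option bool -> vec => forall i,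
    det3 (s (i, None)) (s (i, Some true)) (s (i, Some false)) <> 0).
  apply: generic_all => i; apply: (@generic_fun _ _ _ s0).
    by apply: polyfun_det3; apply: polyvec_coord.
  by rewrite /s0 /= det3_base; apply/eqP; apply: oner_neq0.
(* Prescribe the images of representatives of distinct components. *)
have move3 (x y z : E) (t u v : vec) : exists s,
    [/\ c x != c z -> c y != c z -> phi h s z = v,
        c x != c y -> phi h s y = u, c x != c y -> phi h s x = t
      & forall w, c w != c z -> c x = c y -> phi h s w = h w].
  have [t1 [t2 [t3 et]]] := vlin_move t (nh x).
  have [u1 [u2 [u3 eu]]] := vlin_move u (nh y).
  have [v1 [v2 [v3 ev]]] := vlin_move v (nh z).
  pose row (a b d : vec) (k : option bool) :=
    match k with None => a | Some true => b | Some false => d end.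
  exists (fun i => if (c x != c y) && (i.1 == c x) then row t1 t2 t3 i.2
    else if (c x != c y) && (i.1 == c y) then row u1 u2 u3 i.2
    else if i.1 == c z then row v1 v2 v3 i.2 else s0 i).
  rewrite /phi /=; split.
  - by move=> xz yz; rewrite !(eq_sym (c z)) (negbTE xz) (negbTE yz) !andbF eqxx.
  - by move=> xy; rewrite xy /= eq_sym (negbTE xy) eqxx.
  - by move=> xy; rewrite xy eqxx.
  - by move=> w wz xy; rewrite xy eqxx /= (negbTE wz) vlin_id.
have gP : generic (fun s => forall t : E * E, c t.1 <> c t.2 ->
    cross (phi h s t.1) (phi h s t.2) <> vzero).
  apply: generic_all => -[x y] /=; apply: generic_imp => /eqP xy.
  have [s [_ ey ex _]] := move3 x y x (ve1 F) (ve2 F) (ve3 F).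
  apply: (@generic_vec _ _ _ s); first by apply: polyvec_cross; apply: polymap_phi.
  rewrite ex // ey //; apply: (@det3_neq0_cross _ _ _ (ve3 F)).
  by rewrite det3_base; apply/eqP; apply: oner_neq0.
have gT : generic (fun s => forall t : E * E * E, t.1.1 <> t.1.2 -> c t.1.1 <> c t.2 ->
    c t.1.2 <> c t.2 -> det3 (phi h s t.1.1) (phi h s t.1.2) (phi h s t.2) <> 0).
  apply: generic_all => -[[x y] z] /=; apply: generic_imp => xy.
  apply: generic_imp => /eqP xz; apply: generic_imp => /eqP yz.
  have pf : polyfun (fun s => det3 (phi h s x) (phi h s y) (phi h s z)).
    by apply: polyfun_det3; apply: polymap_phi.
  have [cxy|cxy] := eqVneq (c x) (c y).
    have [t xyt] := det3_neq0_full (pairs _ _ cxy xy).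
    have [s [ez _ _ ew]] := move3 x y z t t t.
    by apply: (@generic_fun _ _ _ s) => //; rewrite ez // !ew.
  have [s [ez ey ex _]] := move3 x y z (ve1 F) (ve2 F) (ve3 F).
  apply: (@generic_fun _ _ _ s) => //; rewrite ex // ey // ez // det3_base.
  by apply/eqP; apply: oner_neq0.
apply: generic_mono (generic_and gD (generic_and gP gT)) => s [sD [sP sT]].
have det_same x y z : c x = c z -> c y = c z -> det3 (phi h s x) (phi h s y) (phi h s z) =
    det3 (s (c z, None)) (s (c z, Some true)) (s (c z, Some false)) * det3 (h x) (h y) (h z).
  by move=> xz yz; rewrite /phi xz yz det3_vlin.
split=> [x y xy|x y z xy yz xz].
  have [cxy|/eqP cxy] := eqVneq (c x) (c y); last exact: (sP (x, y)).
  have [t xyt] := det3_full (pairs _ _ cxy xy).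
  apply: (@det3_neq0_cross _ _ _ (vlin (s (c y, None)) (s (c y, Some true)) (s (c y, Some false)) t)).
  by rewrite /phi cxy det3_vlin xyt mulr1.
have alone x' y' z' : x' <> y' -> c x' <> c z' -> c y' <> c z' ->
    det3 (phi h s x') (phi h s y') (phi h s z') = 0 <-> collinear3 L x' y' z'.
  move=> nxy cxz cyz; split=> [d|/L_c[] _ //].
  by case: (sT (x', y', z')).
have [cxz|/eqP cxz] := eqVneq (c x) (c z); have [cyz|/eqP cyz] := eqVneq (c y) (c z).
- have [xA yA zA] : [/\ x \in A (c z), y \in A (c z) & z \in A (c z)].
    by rewrite !mem_A cxz cyz.
  rewrite det_same // -(same x y z) //.
  by split=> [/eqP|->]; rewrite ?mulr0 // mulf_eq0 (negbTE (introN eqP (sD _))) => /eqP.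
- rewrite -det3_rot alone //; [|exact/nesym|exact/nesym|by rewrite cxz; apply/nesym].
  by split=> [/collinear3_rot|/collinear3_rot/collinear3_rot].
- rewrite det3_rot alone // ?cyz //; [|exact/nesym|exact/nesym].
  by split=> [/collinear3_rot/collinear3_rot|/collinear3_rot].
- exact: alone.
Qed.

Lemma closable_components : (forall x, closable F (L_ (c x))) -> closable F L.
Proof.
move=> clA g wg ng; apply: cl_trans (cl_components clA wg ng) _.
exact: real_components.
Qed.

End Components.

(** * Lines and cycles *)

Section Planar.
Variable F : closedFieldType.
Local Notation vec := (vec F).
Local Notation vzero := (vzero F).

Lemma plane_pairs (H : vec) : H <> vzero ->
  exists u v, cross (cross H u) (cross H v) <> vzero.
Proof.
move=> H0; have [u Hu] := cross_full H0; have [v Huv] := det3_full Hu.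
exists u, v; rewrite (_ : cross _ _ = vscale (det3 H u v) H); last by vring.
by rewrite Huv vscale1.
Qed.

(** The map [cross H] sends 3-space onto the plane orthogonal to [H], so families in this plane are
    parametrized by affine space, and the generic ones are pairwise independent. *)
Lemma cl_plane (E : finType) (g : E -> vec) (H : vec) (C : (E -> vec) -> Prop) :
  H <> vzero -> (forall x, dot H (g x) = 0) ->
  (forall h, (forall x, dot H (h x) = 0) ->
     (forall x y, x <> y -> cross (h x) (h y) <> vzero) -> C h) -> cl C g.
Proof.
move=> H0 Hg HC.
pose phi (s : E -> vec) x := cross H (s x).
have <- : phi (fun x => cross_sol H (g x)) = g.
  by apply: boolp.funext => x; apply: cross_solP.
apply: cl_generic => [x|].
  by apply: polyvec_cross; [exact: polyvec_const | exact: polyvec_coord].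
have gP : generic (fun s => forall t : E * E, t.1 <> t.2 ->
    cross (phi s t.1) (phi s t.2) <> vzero).
  apply: generic_all => -[x y] /=; apply: generic_imp => /eqP xy.
  have [u [v uv]] := plane_pairs H0.
  apply: (@generic_vec _ _ _ (fun z => if z == x then u else v)).
    by apply: polyvec_cross; apply: polyvec_cross; try exact: polyvec_const; exact: polyvec_coord.
  by rewrite /phi eqxx eq_sym (negbTE xy).
apply: generic_mono gP => s sP; apply: HC => [x|x y xy]; first exact: dot_crossl.
exact: (sP (x, y)).
Qed.

Lemma closable_single (E : finType) : closable F [set [set: E]].
Proof.
move=> g wg _; have colT x y z : collinear3 [set [set: E]] x y z.
  by exists setT; rewrite !inE.
have [|H [H0 Hg]] := @exists_plane F E g setT.
  by move=> x y z _ _ _; apply: wg.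
apply: (cl_plane H0 (fun x => Hg x (in_setT x))) => h Hh hp; split=> // x y z xy yz xz.
by split=> // _; apply: det3_perp H0 _ _ _.
Qed.

(** A parametrization by free vectors of the sequences with orthogonal consecutive terms; by
    [chain_full] it reaches all those with nonzero terms. Such sequences alternate normals of planes
    and vectors common to two successive planes. *)
Fixpoint chain (w : nat -> vec) (k : nat) : vec :=
  if k is k'.+1 then cross (chain w k') (w k) else w 0%N.

Lemma chain_dot w k : dot (chain w k) (chain w k.+1) = 0.
Proof. exact: dot_crossl. Qed.

Lemma polyvec_chain E (w : (E -> vec) -> nat -> vec) k :
  (forall i, polyvec (fun s => w s i)) -> polyvec (fun s => chain (w s) k).
Proof. by move=> pw; elim: k => [|k IH] /=; [exact: pw | exact: polyvec_cross]. Qed.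

Lemma chain_full (c : nat -> vec) N : (forall k, (k <= N)%N -> c k <> vzero) ->
  (forall k, (k < N)%N -> dot (c k) (c k.+1) = 0) ->
  exists w, forall k, (k <= N)%N -> chain w k = c k.
Proof.
move=> c0 cc; exists (fun k => if k is k'.+1 then cross_sol (c k') (c k) else c 0%N).
elim=> [|k IH] kN //=; rewrite IH; last exact: ltnW.
by apply: cross_solP; [exact/c0/ltnW | exact: cc].
Qed.

End Planar.

(** * Cycles of at least three lines *)

Section Cycle.
Variable F : closedFieldType.
Local Notation vec := (vec F).
Local Notation vzero := (vzero F).
Variables (E : finType) (m : nat).
Local Notation n := m.+3.
Implicit Types (i j k : 'I_n) (x y z : E).

(* [p k] is the common point of [l k] and [l (ordS k)], so the joints of [l j] are
   [p (ord_pred j)] and [p j]. *)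
Definition cycle_data (p : 'I_n -> E) (l : 'I_n -> {set E}) : Prop :=
  [/\ injective p,
      forall i k, (p k \in l i) = (i == k) || (i == ordS k),
      forall x, exists i, x \in l i,
      forall x, (forall i, x <> p i) -> forall i j, x \in l i -> x \in l j -> i = j
    & forall i j x y, x <> y -> x \in l i -> y \in l i -> x \in l j -> y \in l j -> i = j].

Lemma ordS_neq k : ordS k != k.
Proof.
apply/eqP => /(congr1 val) /=; have := ltn_ord k; rewrite ltnS leq_eqVlt => /orP[/eqP ->|kn].
  by rewrite modnn.
by rewrite modn_small ?ltnS // => /eqP; rewrite gtn_eqF.
Qed.

Lemma ordSS_neq k : ordS (ordS k) != k.
Proof.
apply/eqP => /(congr1 val) /=; rewrite -[_.+1]addn1 modnDml addn1.
have := ltn_ord k; rewrite ltnS leq_eqVlt => /orP[/eqP ->|].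
  by rewrite -addn1 modnDl modn_small.
rewrite ltnS leq_eqVlt => /orP[/eqP ->|kn]; first by rewrite modnn.
by rewrite modn_small // => /eqP; rewrite gtn_eqF // leqW.
Qed.

Section Data.
Variables (p : 'I_n -> E) (l : 'I_n -> {set E}).
Hypothesis data : cycle_data p l.
Local Notation L := [set l i | i : 'I_n].

Let p_inj : injective p. Proof. by case: data. Qed.
Let inc i k : (p k \in l i) = (i == k) || (i == ordS k). Proof. by case: data. Qed.
Let unq x : (forall i, x <> p i) -> forall i j, x \in l i -> x \in l j -> i = j.
Proof. by case: data => _ _ _ h _; apply: h. Qed.
Let two i j x y : x <> y -> x \in l i -> y \in l i -> x \in l j -> y \in l j -> i = j.
Proof. by case: data => _ _ _ _; apply. Qed.

Let p_in j : p j \in l j. Proof. by rewrite inc eqxx. Qed.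
Let pred_in j : p (ord_pred j) \in l j. Proof. by rewrite inc ord_predK eqxx orbT. Qed.
Let pred_neq j : ord_pred j != j.
Proof. by rewrite -{2}(ord_predK j) eq_sym ordS_neq. Qed.

Let colP x y z : collinear3 L x y z <-> exists j, [/\ x \in l j, y \in l j & z \in l j].
Proof.
split=> [[_ [/imsetP[j _ ->] xl yl zl]]|[j [xl yl zl]]]; first by exists j.
by exists (l j); rewrite imset_f.
Qed.

Let noncol x y z := [/\ x <> y, y <> z, x <> z & ~ collinear3 L x y z].

Let noncol_rot x y z : noncol x y z -> noncol y z x.
Proof.
move=> [xy yz xz nc]; split=> //; try exact/nesym.
by move=> /collinear3_rot/collinear3_rot.
Qed.

Variables (idx : E -> 'I_n).
Hypothesis idxP : forall x, x \in l (idx x).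

Definition joint x := [exists a, p a == x].

Lemma jointP x : reflect (exists a, x = p a) (joint x).
Proof. by apply: (iffP existsP) => -[a] => [/eqP <-|->]; exists a. Qed.

Lemma jointN x : ~~ joint x -> forall a, x <> p a.
Proof. by move=> /jointP nx a xa; apply: nx; exists a. Qed.

(** The joints with which [frame_map] can make [x] coincide: itself, or either joint of its only
    line. *)
Definition rep x a :=
  if joint x then x == p a else (a == idx x) || (a == ord_pred (idx x)).

(** If neither joint of the line of [x] could replace [x], some line would contain [y], [z] and both
    joints. The joints identify it as the line of [x], contradicting noncollinearity. *)
Lemma rep_exists x y z : noncol x y z -> exists a, rep x a /\ noncol (p a) y z.
Proof.
move=> nc; rewrite /rep; case: jointP => [[a xa]|/jointP nx].
  by exists a; rewrite -xa eqxx.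
have [xy yz xz ncol] := nc; pose j := idx x; have xj : x \in l j := idxP x.
have ppn : p (ord_pred j) <> p j by move=> /p_inj /eqP; rewrite (negbTE (pred_neq j)).
have key a : p a <> y -> p a <> z -> ~ noncol (p a) y z ->
    exists i, [/\ p a \in l i, y \in l i & z \in l i].
  move=> ay az nca; apply/colP; apply: boolp.contrapT => nc'; apply: nca.
  by split.
have bad i : p (ord_pred j) \in l i -> p j \in l i -> y \in l i -> z \in l i -> False.
  move=> a1 a2 yi zi; have e : i = j by apply: two ppn _ _ _ _.
  by apply: ncol; apply/colP; exists j; split=> //; rewrite -e.
apply: boolp.contrapT => hn.
have n1 : ~ noncol (p j) y z by move=> h; apply: hn; exists j; rewrite eqxx.
have n2 : ~ noncol (p (ord_pred j)) y z.
  by move=> h; apply: hn; exists (ord_pred j); rewrite eqxx orbT.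
have [py|py] := boolp.pselect (p j = y); have [pz|pz] := boolp.pselect (p j = z).
- by apply: yz; rewrite -py.
- have [qz|qz] := boolp.pselect (p (ord_pred j) = z).
    by apply: (bad j) => //; [rewrite -py | rewrite -qz].
  have [|i [a1 yi zi]] := key (ord_pred j) _ qz n2; first by rewrite -py.
  by apply: (bad i) => //; rewrite py.
- have [qy|qy] := boolp.pselect (p (ord_pred j) = y).
    by apply: (bad j) => //; [rewrite -qy | rewrite -pz].
  have [|i [a1 yi zi]] := key (ord_pred j) qy _ n2; first by rewrite -pz.
  by apply: (bad i) => //; rewrite pz.
have [i [a1 yi zi]] := key j py pz n1.
have [qy|qy] := boolp.pselect (p (ord_pred j) = y).
  by apply: (bad i) => //; rewrite qy.
have [qz|qz] := boolp.pselect (p (ord_pred j) = z).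
  by apply: (bad i) => //; rewrite qz.
have [i' [a1' yi' zi']] := key _ qy qz n2.
have e : i = i' by apply: two yz _ _ _ _.
by apply: (bad i) => //; rewrite e.
Qed.

(* The joints move freely; any other point is the combination, with coefficients
   read in its own entry of [s], of the two joints of its line. *)
Definition frame_map (s : E -> vec) (x : E) : vec :=
  if joint x then s x
  else vadd (vscale (vc1 (s x)) (s (p (ord_pred (idx x))))) (vscale (vc2 (s x)) (s (p (idx x)))).

Lemma polymap_frame : polymap frame_map.
Proof.
move=> x; rewrite /frame_map; case: (joint x); first exact: polyvec_coord.
by apply: polyvec_add; apply: polyvec_scale; try exact: polyvec_coord; constructor.
Qed.

Lemma frame_joint s a : frame_map s (p a) = s (p a).
Proof. by rewrite /frame_map; case: jointP => // -[]; exists a. Qed.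

Lemma frame_rep s x a : rep x a -> (joint x \/ s x = if a == idx x then ve2 F else ve1 F) ->
  frame_map s x = s (p a).
Proof.
rewrite /rep /frame_map; case: ifP => [_ /eqP -> //|_ ra [//|->]].
case: eqVneq ra => [-> _|_ /= /eqP <-]; rewrite /ve1 /ve2 /vc1 /vc2 /=.
  by rewrite vscale0 vscale1 v0add.
by rewrite vscale0 vscale1 vadd0.
Qed.

Lemma frame_weak s : weakly_realizes L (frame_map s).
Proof.
have span u j : u \in l j ->
    exists a b, frame_map s u = vadd (vscale a (s (p (ord_pred j)))) (vscale b (s (p j))).
  move=> uj; have [/jointP[k ek]|nu] := boolP (joint u).
    move: uj; rewrite ek inc frame_joint => /orP[/eqP ->|/eqP ->].
      by exists 0, 1; rewrite vscale0 vscale1 v0add.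
    by exists 1, 0; rewrite vscale0 vscale1 vadd0 ordSK.
  rewrite /frame_map (negbTE nu) (unq (jointN nu) (idxP u) uj).
  by exists (vc1 (s u)), (vc2 (s u)).
move=> x y z /colP[j [/span[a [b ->]] /span[c [d ->]] /span[e [f ->]]]]; vring.
Qed.

(** Reduces independence of pairs to that of noncollinear triples. For a pair on [l j] the joint
    [p (ordS j)] is off that line; otherwise one of the at least three joints differs from both
    points. *)
Lemma noncol_third x y : x <> y -> exists z, noncol x y z.
Proof.
move=> xy; have [[j [xj yj]]|nj] := boolp.pselect (exists j, x \in l j /\ y \in l j).
  exists (p (ordS j)).
  have nin : p (ordS j) \notin l j.
    by rewrite inc negb_or [j == _]eq_sym ordS_neq eq_sym ordSS_neq.
  split=> // [e|e|/colP[i [xi yi zi]]].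
  - by rewrite -e yj in nin.
  - by rewrite -e xj in nin.
  - by rewrite (two xy xi yi xj yj) (negbTE nin) in zi.
have [k [kx ky]] : exists k, p k <> x /\ p k <> y.
  apply: boolp.contrapT => hn.
  have sub : [set p k | k : 'I_n] \subset [set x; y].
    apply/subsetP => _ /imsetP[k _ ->]; rewrite !inE.
    apply/negPn/negP; rewrite negb_or => /andP[/eqP kx /eqP ky]; apply: hn.
    by exists k.
  have := subset_leq_card sub; rewrite card_imset // card_ord cards2.
  by case: (x != y).
exists (p k); split=> //; try exact/nesym.
by move=> /colP[i [xi yi _]]; apply: nj; exists i.
Qed.

Lemma cl_frame h : weakly_realizes L h -> (forall j, cross (h (p (ord_pred j))) (h (p j)) <> vzero) ->
  cl (realizes L) h.
Proof.
move=> wh hp.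
have coef x : exists t : vec, ~~ joint x -> h x =
    vadd (vscale (vc1 t) (h (p (ord_pred (idx x))))) (vscale (vc2 t) (h (p (idx x)))).
  have [] := @det3_span _ _ _ (h x) (hp (idx x)).
    by apply: wh; apply/colP; exists (idx x).
  by move=> a [b e]; exists (a, b, 0).
have [t ht] := boolp.choice coef.
pose s0 x := if joint x then h x else t x.
have s0p a : s0 (p a) = h (p a) by rewrite /s0; case: jointP => // -[]; exists a.
have <- : frame_map s0 = h.
  apply: boolp.funext => x; rewrite /frame_map !s0p /s0; case: (boolP (joint x)) => // jx.
  by rewrite -ht.
apply: cl_generic; first exact: polymap_frame.
have gT : generic (fun s => forall t : E * E * E, noncol t.1.1 t.1.2 t.2 ->
    det3 (frame_map s t.1.1) (frame_map s t.1.2) (frame_map s t.2) <> 0).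
  apply: generic_all => -[[x y] z] /=; apply: generic_imp => nc.
  have [a [ra /noncol_rot nca]] := rep_exists nc.
  have [b [rb /noncol_rot ncb]] := rep_exists nca.
  have [c [rc [ca ab cb _]]] := rep_exists ncb.
  have [xy yz xz _] := nc.
  pose sel w a : vec := if a == idx w then ve2 F else ve1 F.
  (* The three representative joints go to the standard basis, and each of [x], [y], [z] that is not
     a joint gets the coefficients that put it on its representative. *)
  pose s w := if w == p a then ve1 F else if w == p b then ve2 F else
    if w == p c then ve3 F else
    if w == x then sel x a else if w == y then sel y b else sel z c.
  have snj w : ~~ joint w -> s w = if w == x then sel x a else if w == y then sel y b else sel z c.
    move=> /jointN jw; rewrite /s.
    by case: eqP => [/jw|] // _; case: eqP => [/jw|] // _; case: eqP => [/jw|] // _.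
  have dich w : joint w \/ ~~ joint w by case: (joint w); [left | right].
  apply: (@generic_fun _ _ _ s); first by apply: polyfun_det3; apply: polymap_frame.
  rewrite (@frame_rep s x a ra); last first.
    by case: (dich x) => [|/snj ->]; [left | right; rewrite eqxx].
  rewrite (@frame_rep s y b rb); last first.
    case: (dich y) => [|/snj ->]; [by left | right].
    by rewrite eqxx; case: eqP => // e; case: xy.
  rewrite (@frame_rep s z c rc); last first.
    case: (dich z) => [|/snj ->]; [by left | right].
    by case: eqP => [e|_]; [case: xz | case: eqP => [e|_]; first by case: yz].
  have -> : s (p a) = ve1 F by rewrite /s eqxx.
  have -> : s (p b) = ve2 F by rewrite /s eqxx; case: eqP => // /esym.
  have -> : s (p c) = ve3 F.
    by rewrite /s eqxx; case: eqP => // _; case: eqP.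
  by rewrite det3_base; apply/eqP; apply: oner_neq0.
apply: generic_mono gT => s sT; split=> [x y /noncol_third[z nc]|x y z xy yz xz].
  exact: (det3_neq0_cross (sT (x, y, z) nc)).
split=> [d|]; last exact: frame_weak.
by apply: boolp.contrapT => nc; apply: (sT (x, y, z)).
Qed.

(** The hypotheses of [cl_frame]: all other points are then combinations of the two joints of their
    line. It remains to approximate by such configurations. *)
Definition nonparallel (h : E -> vec) : Prop :=
  weakly_realizes L h /\ forall j, cross (h (p (ord_pred j))) (h (p j)) <> vzero.

Let perp_weak (H : 'I_n -> vec) h : (forall j, H j <> vzero) ->
  (forall j x, x \in l j -> dot (H j) (h x) = 0) -> weakly_realizes L h.
Proof.
by move=> H0 Hh x y z /colP[j [xj yj zj]]; apply: det3_perp (H0 j) _ _ _; apply: Hh.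
Qed.

Lemma ordS_ind (Q : 'I_n -> Prop) : Q ord0 -> (forall j, Q j -> Q (ordS j)) -> forall j, Q j.
Proof.
move=> Q0 QS j; rewrite -(inord_val j); elim: (val j) (ltn_ord j) => [_|k IH kn].
  by rewrite (_ : inord 0 = ord0) //; apply/val_inj; rewrite /= inordK.
rewrite (_ : inord k.+1 = ordS (inord k)); first exact/QS/IH/ltnW.
by apply/val_inj; rewrite /= !inordK ?modn_small // ltnW.
Qed.

Lemma cl_planar_cycle (H : 'I_n -> vec) g : (forall j, H j <> vzero) ->
  (forall j x, x \in l j -> dot (H j) (g x) = 0) ->
  (forall j, cross (H j) (H (ordS j)) = vzero) -> cl nonparallel g.
Proof.
move=> H0 Hg HH.
have par : forall j, cross (H ord0) (H j) = vzero.
  apply: ordS_ind => [|j Hj]; first exact: crossvv.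
  exact: cross_trans (H0 j) Hj (HH j).
apply: (@cl_plane _ _ _ (H ord0)) => [|x|h Hh hp]; first exact: H0.
  have [a ha] := parallel (par (idx x)) (H0 _).
  have := Hg _ _ (idxP x); rewrite ha dotZl => /eqP; rewrite mulf_eq0 => /orP[/eqP a0|/eqP //].
  by case: (H0 (idx x)); rewrite ha a0 vscale0.
split=> [|j]; first by apply: (@perp_weak (fun=> H ord0)) => // j x _; exact: Hh.
by apply: hp => /p_inj /eqP; rewrite (negbTE (pred_neq j)).
Qed.

(** Term [2j] of the chain is the normal of the plane of [l j], term [2i+1] the joint [p i]. The
    closing joint must lie in the last and the first plane; only its scalar factor is free. *)
Let chain_joint (s : nat + E -> vec) (i : 'I_n) : vec :=
  if val i == m.+2 then
    vscale (vc1 (s (inr (p i)))) (cross (chain (fun k : nat => s (inl k)) m.+2.*2) (chain (fun k : nat => s (inl k)) 0))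
  else chain (fun k : nat => s (inl k)) (val i).*2.+1.

Let chain_map (s : nat + E -> vec) (x : E) : vec :=
  if [pick i | p i == x] is Some i then chain_joint s i
  else cross (chain (fun k : nat => s (inl k)) (val (idx x)).*2) (s (inr x)).

Let chain_map_joint s i : chain_map s (p i) = chain_joint s i.
Proof.
rewrite /chain_map; case: pickP => [j /eqP /p_inj -> //|/(_ i)]; by rewrite eqxx.
Qed.

Let polychain (k : nat) : polyvec (fun s : nat + E -> vec => chain (fun k : nat => s (inl k)) k).
Proof. by apply: polyvec_chain => i; apply: polyvec_coord. Qed.

Let polymap_chain : polymap chain_map.
Proof.
move=> x; rewrite /chain_map; case: pickP => [i _|_].
  rewrite /chain_joint; case: (val i == m.+2); last exact: polychain.
  by apply: polyvec_scale; [constructor | apply: polyvec_cross].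
by apply: polyvec_cross; [exact: polychain | exact: polyvec_coord].
Qed.

Let val_ordS i : val i != m.+2 -> val (ordS i) = (val i).+1.
Proof.
move=> im /=; rewrite modn_small // ltnS ltn_neqAle im /= -ltnS; exact: ltn_ord.
Qed.

Let ordS_max i : val i == m.+2 -> val (ordS i) = 0%N.
Proof. by move=> /eqP /= ->; rewrite modnn. Qed.

Let chain_perp s j x : x \in l j ->
  dot (chain (fun k : nat => s (inl k)) (val j).*2) (chain_map s x) = 0.
Proof.
move=> xj; rewrite /chain_map; case: pickP => [i /eqP ex|nx]; last first.
  rewrite (unq _ (idxP x) xj) ?dot_crossl // => i e.
  by have := nx i; rewrite e eqxx.
move: xj; rewrite -ex inc /chain_joint => /orP[/eqP ->|/eqP ->].
  case: eqP => [->|_]; last exact: chain_dot.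
  by rewrite dotZr dot_crossl mulr0.
case: ifP => [im|/negbT im].
  by rewrite ordS_max // dotZr dot_crossr mulr0.
by rewrite val_ordS // doubleS dotC chain_dot.
Qed.

(* Joints of a nondegenerate member of the family: consecutive ones are not
   parallel, and the last two are independent of the first one. *)
Let qseq (i : nat) : vec :=
  if i == m.+2 then ve3 F else if i == m.+1 then (1, 1, 0)
  else if odd i then ve2 F else ve1 F.

Let one_neq0 : (1 : F) <> 0. Proof. by apply/eqP; apply: oner_neq0. Qed.

Let qseqS (i : nat) : (i < m.+2)%N -> cross (qseq i) (qseq i.+1) <> vzero.
Proof.
move=> im; rewrite /qseq (ltn_eqF im) !eqSS.
have [_|ni] := eqVneq i m.+1.
  vunfold => -[/eqP].
  by rewrite mulr0 mulr1 subr0 oner_eq0.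
have [_|_] := eqVneq i m.
  case: (odd i); vunfold => -[].
  - by move=> _ _ /eqP; rewrite mul0r mulr1 sub0r oppr_eq0 oner_eq0.
  - by move=> _ _ /eqP; rewrite mul0r mulr1 subr0 oner_eq0.
rewrite oddS; case: (odd i); vunfold => -[_ _ /eqP].
  by rewrite !mulr0 mulr1 sub0r oppr_eq0 oner_eq0.
by rewrite !mul0r mulr1 subr0 oner_eq0.
Qed.

Let q0 : qseq 0 = ve1 F. Proof. by []. Qed.
Let qm1 : qseq m.+1 = (1, 1, 0). Proof. by rewrite /qseq eqn_leq ltnn andbF eqxx. Qed.
Let qmax : qseq m.+2 = ve3 F. Proof. by rewrite /qseq eqxx. Qed.

(* The sequence H_0, p_0, H_1, ..., p_(n-2), H_(n-1) of planes and joints is a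
   [chain], and the last joint is a multiple of [cross H_(n-1) H_0]. *)
Lemma cl_twisted_cycle (H : 'I_n -> vec) g : nonzero g -> (forall j, H j <> vzero) ->
  (forall j x, x \in l j -> dot (H j) (g x) = 0) ->
  cross (H ord_max) (H ord0) <> vzero -> cl nonparallel g.
Proof.
move=> ng H0 Hg HH.
pose c0 (k : nat) := if odd k then g (p (inord k./2)) else H (inord k./2).
have [||w0 hw0] := @chain_full F c0 m.+2.*2.
- by move=> k _; rewrite /c0; case: (odd k).
- move=> k kN; have km : (k./2 < m.+2)%N by rewrite ltn_half_double.
  have ki : val (inord k./2 : 'I_n) = k./2 by rewrite /= inordK // ltnW.
  rewrite /c0 /= uphalf_half; case ek: (odd k) => /=.
    rewrite dotC; apply: Hg; rewrite inc; apply/orP; right; apply/eqP/val_inj.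
    by rewrite val_ordS ki /= ?inordK // neq_ltn km.
  by rewrite add0n; apply: Hg; rewrite inc eqxx.
have hH (j : 'I_n) : chain w0 (val j).*2 = H j.
  rewrite hw0 ?leq_double ?leq_ord // /c0 odd_double doubleK; congr H; exact: inord_val.
have gm : exists a, g (p ord_max) = vscale a (cross (H ord_max) (H ord0)).
  by apply: perp2 => //; apply: Hg; rewrite inc; apply/orP; [left | right; apply/eqP/val_inj; rewrite ordS_max].
have [a ga] := gm.
pose s0 (i : nat + E) := match i with
  | inl k => w0 k
  | inr x => if x == p ord_max then (a, 0, 0) else cross_sol (H (idx x)) (g x)
  end.
have <- : chain_map s0 = g.
  apply: boolp.funext => x; rewrite /chain_map; case: pickP => [i /eqP <-|nx].
    rewrite /chain_joint; case: ifP => [/eqP im|/negbT im].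
      have -> : i = ord_max by apply/val_inj.
      by rewrite /s0 eqxx ga -(hH ord_max) -(hH ord0).
    rewrite hw0; last first.
      by rewrite ltn_double ltn_neqAle im -ltnS ltn_ord.
    by rewrite /c0 /= odd_double /= uphalf_double inord_val.
  rewrite hH /s0 ifN; last by apply/eqP => e; have := nx ord_max; rewrite e eqxx.
  by apply: cross_solP => //; apply: Hg.
apply: cl_generic => //.
(* The normal at index [2j] comes from the joints [j - 1] and [j], which are the joints of [l j];
   index 0 closes up cyclically. *)
pose c1 (k : nat) := if odd k then qseq k./2
  else if k == 0%N then cross (qseq m.+2) (qseq 0) else cross (qseq k./2.-1) (qseq k./2).
(* This determinant is 1, and [cross (cross a b) (cross b c)] equals [det3 a b c] times [b], so the
   closing joint comes out as [qseq m.+2] with factor 1. The vector [(1, 1, 0)] is independent of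
   both [ve1] and [ve2], hence fits either parity of [m]. *)
have detq : det3 (qseq m.+1) (qseq m.+2) (qseq 0) <> 0.
  rewrite qm1 qmax q0; vunfold.
  by rewrite !(mulr0, mulr1, mul0r, subr0, sub0r, addr0).
have qN0 : cross (qseq m.+2) (qseq 0) <> vzero.
  by apply: (@det3_neq0_cross _ _ _ (qseq m.+1)); rewrite -det3_rot.
have qn0 (i : nat) : (i <= m.+2)%N -> qseq i <> vzero.
  rewrite leq_eqVlt => /orP[/eqP ->|/qseqS /cross_neq0l //].
  exact: cross_neq0l qN0.
have c1E (j : nat) : (j < m.+2)%N -> c1 j.+1.*2 = cross (qseq j) (qseq j.+1).
  by move=> _; rewrite /c1 odd_double /= doubleK.
have c1O (j : nat) : c1 j.*2.+1 = qseq j.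
  by rewrite /c1 /= odd_double /= uphalf_double.
have c10 : c1 0 = cross (qseq m.+2) (qseq 0) by [].
have c1n0 (j : nat) : (j <= m.+2)%N -> c1 j.*2 <> vzero.
  by case: j => [|j] jm; rewrite ?c10 // c1E //; apply: qseqS.
have [||w1 hw1] := @chain_full F c1 m.+2.*2.
- move=> k kN; rewrite -(odd_double_half k); case ek: (odd k).
    by rewrite add1n c1O; apply: qn0; rewrite leq_half_double leqW.
  by rewrite add0n; apply: c1n0; rewrite leq_half_double leqW.
- move=> k kN; have km : (k./2 < m.+2)%N by rewrite ltn_half_double.
  rewrite -(odd_double_half k); case ek: (odd k).
    by rewrite add1n c1O -doubleS c1E // dot_crossl.
  rewrite add0n c1O; case: (k./2) km => [|j] jm; first by rewrite c10 dotC dot_crossr.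
  by rewrite c1E 1?ltnW // dotC dot_crossr.
pose s1 (i : nat + E) : vec := match i with inl k => w1 k | inr _ => ve1 F end.
have s1q (i : 'I_n) : chain_joint s1 i = qseq (val i).
  rewrite /chain_joint; case: eqP => [->|/eqP im].
    by rewrite /s1 hw1 // c1E // (hw1 0%N) // c10 qm1 qmax q0; vring.
  rewrite hw1 ?c1O // ltn_double ltn_neqAle im -ltnS; exact: ltn_ord.
have gA : generic (fun s : nat + E -> vec => forall j : 'I_n,
    chain (fun k : nat => s (inl k)) (val j).*2 <> vzero).
  apply: generic_all => j; apply: (@generic_vec _ _ _ s1) => //.
  by rewrite hw1 ?leq_double ?leq_ord //; apply: c1n0; rewrite leq_ord.
have gB : generic (fun s : nat + E -> vec => forall j : 'I_n,
    cross (chain_map s (p (ord_pred j))) (chain_map s (p j)) <> vzero).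
  apply: generic_all => j; apply: (@generic_vec _ _ _ s1).
    by apply: polyvec_cross; apply: polymap_chain.
  rewrite !chain_map_joint !s1q -{2}(ord_predK j).
  have [im|im] := boolP (val (ord_pred j) == m.+2); first by rewrite ordS_max // (eqP im).
  rewrite val_ordS //; apply: qseqS; rewrite ltn_neqAle im -ltnS; exact: ltn_ord.
apply: generic_mono (generic_and gA gB) => s [sA sB]; split=> //.
apply: (@perp_weak (fun j => chain (fun k : nat => s (inl k)) (val j).*2)) => // j x.
exact: chain_perp.
Qed.

End Data.

Lemma cycle_data_rot p l (t t' : 'I_n -> 'I_n) : cancel t' t -> injective t ->
  (forall i, t (ordS i) = ordS (t i)) -> cycle_data p l ->
  cycle_data (fun i => p (t i)) (fun i => l (t i)).
Proof.
move=> t'K ti tS [p_inj inc cov unq two]; split.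
- exact: inj_comp p_inj ti.
- by move=> i k; rewrite inc -tS !(inj_eq ti).
- by move=> x; have [i xi] := cov x; exists (t' i); rewrite t'K.
- move=> x nx i j xi xj; apply/ti/(unq x) => // k; rewrite -(t'K k); exact: nx.
- by move=> i j x y xy xi yi xj yj; apply/ti/(two _ _ x y).
Qed.

Lemma iter_ordS_max (i : 'I_n) : iter i.+1 (@ordS n) ord_max = i.
Proof.
apply/val_inj; case: i => k /=; elim: k => [|k IH] kn; first by rewrite /= modnn.
by rewrite iterS /= IH ?modn_small // ltnW.
Qed.

Lemma closable_cycle (p : 'I_n -> E) (l : 'I_n -> {set E}) :
  cycle_data p l -> closable F [set l i | i : 'I_n].
Proof.
move=> data g wg ng; have [p_inj inc cov unq two] := data.
have [idx idxP] := boolp.choice cov.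
apply: (@cl_trans _ _ (nonparallel p l)); last by move=> h [wh hp]; apply: (cl_frame data idxP).
have exH i : exists h, h <> vzero /\ forall x, x \in l i -> dot h (g x) = 0.
  apply: exists_plane => x y z xi yi zi; apply: wg; exists (l i); by rewrite imset_f.
have [H HP] := boolp.choice exH.
have H0 i : H i <> vzero by have [] := HP i.
have Hg i x : x \in l i -> dot (H i) (g x) = 0 by have [_] := HP i; apply.
have [[i0 Hi0]|hn] := boolp.pselect (exists i, cross (H i) (H (ordS i)) <> vzero); last first.
  apply: (cl_planar_cycle data idxP H0 Hg) => i.
  by apply: boolp.contrapT => h; apply: hn; exists i.
(* The indices are rotated so that the two consecutive nonparallel planes become the last and the
   first. *)
pose t := iter i0.+1 (@ordS n); pose t' := iter i0.+1 (@ord_pred n).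
have iterK a (f f' : 'I_n -> 'I_n) : cancel f f' -> cancel (iter a f) (iter a f').
  by move=> fK; elim: a => [|a IH] x //=; rewrite -iterS iterSr fK IH.
have t'K : cancel t' t by apply: iterK; apply: ord_predK.
have tK : cancel t t' by apply: iterK; apply: ordSK.
have tS i : t (ordS i) = ordS (t i) by rewrite /t -iterSr.
have tmax : t ord_max = i0 by apply: iter_ordS_max.
have tP i : t (ord_pred i) = ord_pred (t i) by rewrite -{2}(ord_predK i) tS ordSK.
have S0 : ord0 = ordS (ord_max : 'I_n) by apply/val_inj; rewrite /= modnn.
have := @cl_twisted_cycle _ _ (cycle_data_rot t'K (can_inj tK) tS data) (fun x => t' (idx x))
  _ (fun i => H (t i)) g ng _ _ _.
have -> : nonparallel (fun i => p (t i)) (fun i => l (t i)) = nonparallel p l.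
  apply: boolp.funext => h; rewrite /nonparallel.
  have -> : [set l (t i) | i : 'I_n] = [set l i | i : 'I_n].
    apply/setP => A; apply/imsetP/imsetP => -[i _ ->]; first by exists (t i).
    by exists (t' i); rewrite ?t'K.
  apply: boolp.propext; split=> -[wh hp]; split=> // j; last by rewrite tP.
  by have := hp (t' j); rewrite tP t'K.
apply=> [x|j|j x|]; rewrite ?t'K //; first exact: Hg.
by rewrite S0 tS tmax.
Qed.

End Cycle.

(** * Cactus configurations *)

Section Cactus.
Variable F : closedFieldType.

(** Short lengths are degenerate: without lines there are no points, a single line contradicts
    degree two, and two lines would share two points. *)
Lemma cycle_shape (E : finType) (M : matroid E) : is_cycle M ->
  (E -> False) \/ exists m (p : 'I_m.+3 -> E) (l : 'I_m.+3 -> {set E}),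
    cycle_data p l /\ lines M = [set l i | i : 'I_m.+3].
Proof.
move=> [plM [n [p [l [p_inj [l_inj eL] hp hx]]]]].
have deg1 x : (forall i, x <> p i) -> exists A, forall B, B \in lines M -> x \in B -> B = A.
  move=> /hx /eqP /cards1P[A eA]; exists A => B BM xB.
  by apply/set1P; rewrite -eA inE BM.
have cov x : exists i, x \in l i.
  have [[i ->]|nx] := boolp.pselect (exists i, x = p i).
    exists i; have [e _] := hp i.
    have : l i \in lines_at M (p i) by rewrite e set21.
    by rewrite inE => /andP[].
  have : degree M x = 1%N by apply: hx => i xi; apply: nx; exists i.
  move=> /eqP /cards1P[A eA]; have : A \in lines_at M x by rewrite eA set11.
  by rewrite inE eL => /andP[/imsetP[i _ ->] xA]; exists i.
have lM i : l i \in lines M by rewrite eL imset_f.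
have inc i k : (p k \in l i) = (i == k) || (i == ordS k).
  have [e _] := hp k; have := in_set2 (l i) (l k) (l (ordS k)).
  by rewrite -e inE lM /= !(inj_eq l_inj).
have two i j x y : x <> y -> x \in l i -> y \in l i -> x \in l j -> y \in l j -> i = j.
  by move=> xy xi yi xj yj; apply: l_inj; apply: (line_eq plM (lM i) (lM j) xy).
case: n p l p_inj l_inj eL hp hx deg1 cov lM inc two => [|[|[|m]]] p l p_inj l_inj eL hp hx deg1 cov lM inc two.
- by left=> x; have [[]] := cov x.
- have [e] := hp ord0; rewrite /degree e (_ : ordS _ = ord0) ?setUid ?cards1 //.
  by rewrite ord1.
- have o : @ord0 1 = ord_max.
    by apply: (two _ _ (p ord0) (p ord_max)); rewrite ?inc //; move/p_inj.
  by [].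
right; exists m, p, l; split=> //; split=> //.
move=> x /deg1[A hA] i j xi xj; apply: l_inj.
by rewrite (hA _ (lM i) xi) (hA _ (lM j) xj).
Qed.

Lemma closable_is_cycle (E : finType) (M : matroid E) : is_cycle M -> closable F (lines M).
Proof.
move=> /cycle_shape[E0|[m [p [l [data ->]]]]]; last exact: closable_cycle data.
move=> g _ _; apply: cl_sub; split=> x; by have := E0 x.
Qed.

Lemma closable_block (E : finType) (M : matroid E) : is_single_line M \/ is_cycle M ->
  closable F (lines M).
Proof.
by move=> [/lines_single ->|]; [apply: closable_single | apply: closable_is_cycle].
Qed.

Lemma closable_connected_cactus (E : finType) (M : matroid E) :
  connected_cactus M -> closable F (lines M).
Proof.
elim=> {E M} [E M sM|E M cM|E1 E2 E M N p q K _ cM bN].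
- by apply: closable_block; left.
- by apply: closable_block; right.
move=> [_ [f [g [[fi gi] fp fg cov ->]]]].
exact: closable_glue fi gi fp fg cov cM (closable_block bN).
Qed.

(** A second point in the component turns the pair condition of [realizes] into nonvanishing of each
    vector. *)
Lemma connected_cactus_partner (E : finType) (M : matroid E) (x : E) :
  connected_cactus M -> exists y, x <> y.
Proof.
have big (T : finType) (A : {set T}) (z : T) : (2 < #|A|)%N -> exists y, z <> y.
  move=> cA; have : (0 < #|A :\ z|)%N.
    by have := cardsD1 z A; case: (z \in A) => e; move: cA; rewrite e //; case: #|_|.
  by move=> /card_gt0P[y]; rewrite !inE => /andP[/eqP yz _]; exists y; apply/nesym.
have block (T : finType) (N : matroid T) (z : T) : is_single_line N \/ is_cycle N ->
    exists y, z <> y.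
  move=> [[cT _]|/cycle_shape[T0|[m [p [l [_ eL]]]]]].
  - by apply: (big _ setT); rewrite cardsT.
  - by have := T0 z.
  - by apply: (big _ (l ord0)); apply: (@line_card _ N); rewrite eL imset_f.
move=> cM; elim: cM x => {E M} [E M sM|E M cM|E1 E2 E M N p q K _ IH bN glK] x.
- exact: (block _ M x (or_introl sM)).
- exact: (block _ M x (or_intror cM)).
have [_ [f [g [[fi gi] _ _ cov _]]]] := glK.
case: (cov x) => -[y ->].
  by have [z yz] := IH y; exists (f z) => /fi.
by have [z yz] := block _ _ y bN; exists (g z) => /gi.
Qed.

Lemma closable_cactus (E : finType) (M : matroid E) : cactus M -> closable F (lines M).
Proof.
move=> [plM cM]; pose c := fingraph.root (collinear M).
have csym : connect_sym (collinear M).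
  apply: sym_connect_sym => x y; apply/existsP/existsP => -[l /and3P[lM xl yl]];
    by exists l; rewrite lM xl yl.
have mem_A x y : (y \in component M (c x)) = (c y == c x).
  by rewrite inE -(root_connect csym) root_root // eq_sym.
apply: (@closable_components _ _ _ c (component M)
  (fun i => lines (restriction M (component M i)))) => //.
- by move=> i x y z; apply: collinear3_restriction.
- move=> x y z [l [lM xl yl zl]].
  have co a b : a \in l -> b \in l -> c a = c b.
    move=> al bl; apply/eqP; rewrite root_connect //; apply: connect1.
    by apply/existsP; exists l; rewrite lM al bl.
  by split; apply: co.
- move=> x; have xA : x \in component M (c x) by rewrite mem_A.
  have [[y yA] xy] := connected_cactus_partner (Sub x xA) (cM (c x)).
  exists y; split; last by have : y \in component M (c x) := yA; rewrite mem_A => /eqP ->.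
  by move=> e; apply: xy; apply/val_inj.
- by move=> x; apply: closable_connected_cactus.
Qed.

End Cactus.

(** * Forests and zero columns *)

Lemma cycle_nth (T : Type) (e : rel T) t0 c i : cycle e c -> (i < size c)%N ->
  e (nth t0 c i) (nth t0 c (i.+1 %% size c)).
Proof.
case: c => // t c /= /(pathP t0) cc ic; have := cc i.
rewrite size_rcons => /(_ ic); rewrite -rcons_cons !nth_rcons ic.
move: ic; rewrite /= ltnS leq_eqVlt => /orP[/eqP ->|ic].
  by rewrite ltnn eqxx modnn.
by rewrite ic modn_small ?ltnS.
Qed.

Section Forest.
Variable E : finType.
Implicit Types (Y : {set E}) (D : {set {set E}}) (s c : seq (E * {set E})).

Local Notation link := (fun t t' : E * {set E} => t.1 \in t'.2).

(** Paths of the incidence graph of points and lines are stored as sequences of incident pairs;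
    [link] puts the point of each pair on the line of the next one. *)
Definition flags Y D s : bool :=
  [&& all (fun t => [&& t.1 \in Y, t.2 \in D & t.1 \in t.2]) s,
      uniq (unzip1 s) & uniq (unzip2 s)].

(** A cycle of the incidence graph. Size two, that is, two points on two lines, is allowed here and
    excluded later by [line_eq]. *)
Definition has_cycle Y D : Prop :=
  exists c, [/\ flags Y D c, cycle link c & (1 < size c)%N].

Lemma has_cycle_sub Y Y' D D' : Y \subset Y' -> D \subset D' ->
  has_cycle Y D -> has_cycle Y' D'.
Proof.
move=> sY sD [c [/and3P[cYD u1 u2] cc sc]]; exists c; split=> //.
apply/and3P; split=> //; apply: sub_all cYD => t /and3P[tY tD tt].
by rewrite (subsetP sY) // (subsetP sD).
Qed.

Lemma card_le1_eq (T : finType) (A : {set T}) (a0 : T) : (#|A| <= 1)%N ->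
  exists a, forall b, b \in A -> b = a.
Proof.
move=> /card_le1_eqP A1; case: (set_0Vmem A) => [->|[a aA]].
  by exists a0 => b; rewrite inE.
by exists a => b bA; apply: A1.
Qed.

Lemma card_le2_eq (T : finType) (A : {set T}) (a0 : T) : (#|A| <= 2)%N ->
  exists a b : T, forall c : T, c \in A -> c = a \/ c = b.
Proof.
move=> A2; case: (set_0Vmem A) => [->|[a aA]].
  by exists a0, a0 => b; rewrite inE.
have [|b hb] := @card_le1_eq _ (A :\ a) a0.
  by move: A2; rewrite (cardsD1 a) aA.
exists a, b => c cA; have [->|ca] := eqVneq c a; first by left.
by right; apply: hb; rewrite !inE ca.
Qed.

Lemma exists_other (T : finType) (A : {set T}) (a : T) : (1 < #|A|)%N ->
  exists b, b \in A /\ b <> a.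
Proof.
move=> A1; have : (0 < #|A :\ a|)%N.
  by have := cardsD1 a A; case: (a \in A) => e; move: A1; rewrite e //; case: #|_|.
by move=> /card_gt0P[b]; rewrite !inE => /andP[/eqP ba bA]; exists b.
Qed.

(* Otherwise an alternating path of points and lines can be prolonged forever,
   and it has to meet itself. *)
Lemma exists_leaf Y D : Y != set0 \/ D != set0 -> ~ has_cycle Y D ->
  (exists x, x \in Y /\ (#|[set l in D | x \in l]| <= 1)%N) \/
  (exists l, l \in D /\ (#|l :&: Y| <= 1)%N).
Proof.
move=> ne nc; apply: boolp.contrapT => /boolp.not_orP[nY nD].
have dY x : x \in Y -> (1 < #|[set l in D | x \in l]|)%N.
  by move=> xY; rewrite ltnNge; apply/negP => h; apply: nY; exists x.
have dD l : l \in D -> (1 < #|l :&: Y|)%N.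
  by move=> lD; rewrite ltnNge; apply/negP => h; apply: nD; exists l.
have [x0 x0Y] : exists x, x \in Y.
  case: ne => [/set0Pn //|/set0Pn[l /dD h]].
  have /card_gt0P[x] : (0 < #|l :&: Y|)%N by apply: ltnW.
  by rewrite inE => /andP[_ xY]; exists x.
have grow k : exists t s, [/\ flags Y D (t :: s), path link t s & size s = k].
  elim: k => [|k [[x l] [s [fl ps ss]]]].
    have [l [+ _]] := exists_other set0 (dY _ x0Y); rewrite inE => /andP[lD xl].
    by exists (x0, l), [::]; rewrite /flags /= x0Y lD xl.
  have [/allP al u1 u2] := and3P fl.
  have /and3P[/= xY lD xl] := al (x, l) (mem_head _ _).
  have [y [+ yx]] := exists_other x (dD _ lD); rewrite inE => /andP[yl yY].
  (* The path is prolonged at its head, through a point [y] of [l] and then a line [m] on [y]. A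
     repetition closes a cycle with the part of the path before the repeated pair; that pair is kept
     if its point repeats and dropped if its line does. *)
  have [yin|yout] := boolP (y \in unzip1 s).
    case: nc; have /mapP[[y' m] ts /= ey] := yin.
    move: fl ps; case/splitPr: ts => s1 s2 fl ps.
    exists ((x, l) :: rcons s1 (y, m)); rewrite ey; split.
    - move: fl; rewrite -cat_rcons -ey /flags -cat_cons all_cat /unzip1 /unzip2 !map_cat !cat_uniq.
      by move=> /and3P[/andP[-> _] /and3P[-> _ _] /and3P[-> _ _]].
    - rewrite (cycle_path (x, l)) /= last_rcons /= -ey yl /=.
      by move: ps; rewrite cat_path rcons_path -ey /= => /and3P[-> -> _].
    - by rewrite /= size_rcons.
  have [m [+ ml]] := exists_other l (dY _ yY); rewrite inE => /andP[mD ym].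
  have yx' : y \notin unzip1 ((x, l) :: s).
    by rewrite inE negb_or yout andbT; apply/eqP.
  have [min|mout] := boolP (m \in unzip2 s).
    case: nc; have /mapP[[z m'] ts /= em] := min.
    move: fl ps yx'; case/splitPr: ts => s1 s2 fl ps yx'.
    exists ((y, m) :: (x, l) :: s1); split=> //.
    - move: fl yx'; rewrite -cat_cons /flags /unzip1 /unzip2 all_cat !map_cat !cat_uniq mem_cat.
      rewrite negb_or => /and3P[/andP[a1 _] /and3P[v1 _ _] /and3P[v2 dj _]] /andP[ny _].
      apply/and3P; split; first by rewrite /= -/(all _ s1) yY mD ym; exact: a1.
        by rewrite map_cons cons_uniq v1 andbT.
      rewrite map_cons cons_uniq v2 andbT; apply: contra dj => mi.
      by apply/hasP; exists m => //=; rewrite inE em eqxx.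
    - rewrite /= yl rcons_path /=; move: ps; rewrite cat_path /= => /and3P[-> + _].
      by rewrite em.
  exists (y, m), ((x, l) :: s); split=> //=; last by rewrite ss.
    have /and3P[f1 f2 f3] := fl; apply/and3P; split; apply/andP; split=> //.
      by rewrite /= yY mD ym.
    by rewrite inE negb_or mout andbT; apply/eqP.
  by rewrite yl.
have [t [s [/and3P[_ u1 _] _ ss]]] := grow #|E|.
have := max_card (mem (unzip1 (t :: s))); rewrite (card_uniqP u1) size_map /= ss.
by rewrite ltnn.
Qed.

Lemma has_cycle_contains (M : matroid E) Y : point_line M ->
  has_cycle Y (lines M) -> contains_cycle M Y.
Proof.
move=> plM [c [/and3P[/allP al u1 u2] cc sc]].
have [t0 _] : exists t, t \in c by case: c sc {al u1 u2 cc} => // t c' _; exists t; apply: mem_head.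
pose k := size c; have k0 : (0 < k)%N by apply: ltnW.
pose x (i : 'I_k) := (nth t0 c i).1.
(* The shift by one makes [l i] contain both [x i] and [x (ordS i)]. *)
pose l (i : 'I_k) := (nth t0 c (ordS i)).2.
have inc (i : 'I_k) : nth t0 c i \in c by apply: mem_nth.
have lk (i : 'I_k) : link (nth t0 c i) (nth t0 c (ordS i)).
  exact: (cycle_nth t0 cc (ltn_ord i)).
have ki (i : 'I_k) : (val i < size c)%N := ltn_ord i.
have x_inj : injective x.
  move=> i j exy; apply/val_inj/eqP; rewrite -(nth_uniq t0.1 _ _ u1) ?size_map ?ki //.
  by rewrite !(nth_map t0) ?ki //; apply/eqP.
have l_inj : injective l.
  move=> i j exy; apply: ordS_inj; apply/val_inj/eqP.
  by rewrite -(nth_uniq t0.2 _ _ u2) ?size_map ?ki // !(nth_map t0) ?ki //; apply/eqP.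
have xl i : x i \in l i by apply: lk.
have xSl i : x (ordS i) \in l i by have /and3P[] := al _ (inc (ordS i)).
have lM i : l i \in lines M by have /and3P[] := al _ (inc (ordS i)).
exists k; split; last first.
  exists x, l; split=> // i; by have /and3P[] := al _ (inc i).
(* For [k = 2] the two lines would share two points and hence be equal. *)
rewrite ltn_neqAle sc andbT; apply/negP => /eqP k2.
pose i0 := Ordinal k0; have x01 : x i0 <> x (ordS i0).
  by move=> /x_inj /(congr1 val) /=; rewrite -k2.
have S2 : ordS (ordS i0) = i0 by apply/val_inj; rewrite /= -/k -k2.
have /l_inj e : l i0 = l (ordS i0).
  apply: (line_eq plM (lM i0) (lM (ordS i0)) x01 (xl i0) (xSl i0) _ (xl (ordS i0))).
  by have := xSl (ordS i0); rewrite S2.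
by apply: x01; rewrite -e.
Qed.

End Forest.

(** * Filling the zero columns *)

Section Completion.
Variable F : closedFieldType.
Local Notation vec := (vec F).
Local Notation vzero := (vzero F).
Variable E : finType.
Implicit Types (Y : {set E}) (D : {set {set E}}) (x y : E) (l : {set E}).

(** Each unknown has one prescribed condition, [b] for points and [a] for lines. A leaf has at most
    one neighbour, hence at most two conditions once the rest is solved. *)
Lemma forest_solve Y D (b : E -> vec) (a : {set E} -> vec) : ~ has_cycle Y D ->
  exists (u : E -> vec) (h : {set E} -> vec),
  [/\ forall x, x \in Y -> u x <> vzero /\ dot (u x) (b x) = 0,
      forall l, l \in D -> h l <> vzero /\ dot (h l) (a l) = 0
    & forall x l, x \in Y -> l \in D -> x \in l -> dot (u x) (h l) = 0].
Proof.
have [k] := ubnP (#|Y| + #|D|); elim: k Y D => // k IH Y D; rewrite ltnS => szk nc.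
have [e|ne] := boolP ((Y == set0) && (D == set0)).
  move/andP: e => [/eqP -> /eqP ->]; exists (fun=> vzero), (fun=> vzero).
  by split=> x; rewrite inE.
have [|[x [xY x1]]|[l [lD l1]]] := @exists_leaf E Y D _ nc.
- by move: ne; rewrite negb_and => /orP.
- have [l hl] := card_le1_eq set0 x1.
  have [|ncx|u [h [uP hP uh]]] := IH (Y :\ x) D.
  + by apply: leq_trans szk; rewrite (cardsD1 x Y) xY add1n addSn.
  + by apply: nc; apply: has_cycle_sub ncx => //; apply: subD1set.
  have [v [v0 vb vh]] := exists_perp2 (b x) (h l).
  exists (fun y => if y == x then v else u y), h; split=> // [y yY|y l' yY l'D yl'].
    by case: eqVneq => [->|yx] //; apply: uP; rewrite !inE yx.
  case: eqVneq => [eyx|yx]; last by apply: uh; rewrite // !inE yx.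
  by rewrite (hl l') // inE l'D -eyx.
have [|ncl|u [h [uP hP uh]]] := IH Y (D :\ l).
- by apply: leq_trans szk; rewrite (cardsD1 l D) lD add1n addnS.
- by apply: nc; apply: has_cycle_sub ncl => //; apply: subD1set.
have [v [v0 va vu]] : exists v, [/\ v <> vzero, dot v (a l) = 0 &
    forall x, x \in Y -> x \in l -> dot (u x) v = 0].
  case: (set_0Vmem (l :&: Y)) => [e|[x xl]].
    have [v [v0 va _]] := exists_perp2 (a l) (a l); exists v; split=> // x xY xl.
    by have := in_set0 x; rewrite -e inE xl xY.
  have [v [v0 va vu]] := exists_perp2 (a l) (u x); exists v; split=> // y yY yl.
  rewrite (_ : y = x) 1?dotC //; move/card_le1_eqP: l1; apply=> //.
  by rewrite inE yl.
exists u, (fun m => if m == l then v else h m); split=> // [m mD|x m xY mD xm].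
  by case: eqVneq => [->|ml] //; apply: hP; rewrite !inE ml.
case: eqVneq => [eml|ml]; last by apply: uh; rewrite // !inE ml.
by apply: vu; rewrite -?eml.
Qed.

(** Lines of rank two keep their forced plane and leave the forest. What they impose on a zero point
    of high degree is the single condition [b], by the terminal hypothesis; each remaining line only
    has to contain its axis [a]. *)
Lemma nonzero_completion (L : {set {set E}}) (g : E -> vec) :
  weakly_realizes L g ->
  ~ has_cycle [set x | (3 <= #|[set l in L | x \in l]|)%N] L ->
  (forall x l1 l2 p1 p2 p3 p4, g x = vzero -> l1 \in L -> l2 \in L -> l1 != l2 ->
    x \in l1 -> x \in l2 -> p1 \in l1 -> p2 \in l1 -> p3 \in l2 -> p4 \in l2 ->
    cross (cross (g p1) (g p2)) (cross (g p3) (g p4)) = vzero) ->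
  exists u : E -> vec, [/\ weakly_realizes L u, nonzero u & forall x, g x = vzero \/ u x = g x].
Proof.
move=> wg nc term.
pose Y := [set x | (g x == vzero) && (3 <= #|[set l in L | x \in l]|)%N].
pose rank2 l := [exists x in l, exists y in l, cross (g x) (g y) != vzero].
have plane l : exists N, l \in L -> rank2 l -> [/\ N <> vzero,
    exists x y, [/\ x \in l, y \in l & N = cross (g x) (g y)] &
    forall x, x \in l -> dot N (g x) = 0].
  have [lL|/negP lL] := boolP (l \in L); last by exists vzero.
  have [|[N [N0 Nxy Ng]]|[a ha]] := @rank2_or_rank1 F E g l.
  - by move=> x y z xl yl zl; apply: wg; exists l.
  - by exists N.
  - exists vzero => _ /exists_inP[x xl /exists_inP[y yl /eqP xy]]; case: xy.
    have [c ->] := ha _ xl; have [d ->] := ha _ yl.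
    by rewrite crossZl crossZr crossvv !vscalev0.
have {plane}[N NP] := boolp.choice plane.
(* A line of rank at most one asks of its plane only to contain one vector. *)
have axis l : exists a, l \in L -> ~~ rank2 l -> forall x, x \in l -> exists c, g x = vscale c a.
  have [lL|/negP lL] := boolP (l \in L); last by exists vzero.
  have [|[h [h0 [x [y [xl yl hxy]]] _]]|[a ha]] := @rank2_or_rank1 F E g l.
  - by move=> x y z xl yl zl; apply: wg; exists l.
  - exists vzero => _ /negP []; apply/exists_inP; exists x => //; apply/exists_inP.
    by exists y => //; apply/eqP; rewrite -hxy.
  - by exists a.
have {axis}[a aP] := boolp.choice axis.
(* The normals of the rank two lines through [x] are all parallel, so one of them represents the
   conditions of all. *)
have common x : exists b, x \in Y -> forall l, l \in L -> x \in l -> rank2 l ->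
    exists c, N l = vscale c b.
  have [xY|/negP nx] := boolP (x \in Y); last by exists vzero.
  have [[l [lL xl r2]]|hn] := boolp.pselect (exists l, [/\ l \in L, x \in l & rank2 l]); last first.
    by exists vzero => _ l lL xl r2; case: hn; exists l.
  have [N0 [p1 [p2 [l1 l2 e]]] _] := NP l lL r2.
  exists (N l) => _ l' l'L xl' r2'; apply: parallel => //.
  have [->|ll'] := eqVneq l' l; first exact: crossvv.
  have [_ [p3 [p4 [l3 l4 e']]] _] := NP l' l'L r2'.
  rewrite e e'; apply: (term x l l') => //; last by rewrite eq_sym.
  by move: xY; rewrite inE => /andP[/eqP].
have {common}[b bP] := boolp.choice common.
have [|v [h [vP hP vh]]] := @forest_solve Y [set l in L | ~~ rank2 l] b a.
  move=> ncY; apply: nc; apply: has_cycle_sub ncY; apply/subsetP => x; rewrite !inE.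
    by case/andP.
  by case/andP.
pose H l := if rank2 l then N l else h l.
have HP l : l \in L -> H l <> vzero /\ forall x, x \in l -> dot (H l) (g x) = 0.
  move=> lL; rewrite /H; case: ifP => [/(NP l lL)[] //|/negbT r1].
  have [|h0 ha] := hP l; first by rewrite inE lL.
  by split=> // x /(aP l lL r1)[c ->]; rewrite dotZr ha mulr0.
have key x : exists w, [/\ w <> vzero, g x = vzero \/ w = g x &
    forall l, l \in L -> x \in l -> dot (H l) w = 0].
  have [g0|g0] := eqVneq (g x) vzero; last first.
    exists (g x); split=> //; [exact/eqP | by right |].
    by move=> l lL xl; have [_] := HP l lL; apply.
  have [d3|d2] := leqP 3 #|[set l in L | x \in l]|.
    have xY : x \in Y by rewrite inE g0 eqxx.
    have [v0 vb] := vP x xY; exists (v x); split=> //; first by left.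
    move=> l lL xl; rewrite /H; case: ifP => [r2|/negbT r1].
      by have [c ->] := bP x xY l lL xl r2; rewrite dotZl dotC vb mulr0.
    by rewrite dotC; apply: vh; rewrite // inE lL.
  have [l1 [l2 hl]] := card_le2_eq set0 d2.
  have [w [w0 w1 w2]] := exists_perp2 (H l1) (H l2); exists w; split=> //; first by left.
  move=> l lL xl; rewrite dotC; have [|-> //|-> //] := hl l.
  by rewrite inE lL.
have [u uP] := boolp.choice key; exists u; split.
- move=> x y z [l [lL xl yl zl]]; have [H0 _] := HP l lL.
  by apply: det3_perp H0 _ _ _; [have [_ _] := uP x | have [_ _] := uP y | have [_ _] := uP z]; apply.
- by move=> x; have [] := uP x.
- by move=> x; have [] := uP x.
Qed.

End Completion.

(** * Coordinates and the theorem *)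

Section Coordinates.
Variables (F : closedFieldType) (d : nat).
Local Notation vec := (vec F).
Local Notation vzero := (vzero F).
Local Notation point := 'M[F]_(3, d).
Local Notation poly := {mpoly F[3 * d]}.

Definition cols (g : point) (j : 'I_d) : vec := (g 0 j, g 1 j, g (1 + 1) j).

Definition vcoord (v : vec) (i : 'I_3) : F :=
  if val i == 0%N then vc1 v else if val i == 1%N then vc2 v else vc3 v.

Definition mx_of (s : 'I_d -> vec) : point := \matrix_(i, j) vcoord (s j) i.

Lemma ord3 (i : 'I_3) : [\/ i = 0, i = 1 | i = 1 + 1].
Proof.
by case: i => [[|[|[|m]]]] lti //; [apply: Or31 | apply: Or32 | apply: Or33]; apply/val_inj.
Qed.

Lemma cols_mx s : cols (mx_of s) = s.
Proof.
by apply: boolp.funext => j; rewrite /cols !mxE /vcoord /=; case: (s j) => [[]].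
Qed.

Lemma mx_cols g : mx_of (cols g) = g.
Proof.
by apply/matrixP => i j; rewrite mxE /cols; case: (ord3 i) => ->.
Qed.

Definition evalc (f : poly) (s : 'I_d -> vec) : F := evalmx f (mx_of s).

Lemma polyfun_evalc f : polyfun (evalc f).
Proof.
elim/mpoly_gen_ind: f => [c|k|f g pf pg|f g pf pg].
- by apply: polyfun_ext (polyfun_const _ c) => s; rewrite /evalc /evalmx mevalC.
- case/mxvec_indexP: k => i j.
  have e s : evalc 'X_(mxvec_index i j) s = vcoord (s j) i.
    by rewrite /evalc /evalmx mevalXU mxvecE mxE.
  apply: (@polyfun_ext _ _ (fun s => vcoord (s j) i)) => // {e}.
  by rewrite /vcoord; case: (val i == 0%N); [|case: (val i == 1%N)]; constructor.
- by apply: polyfun_ext (polyfun_add pf pg) => s; rewrite /evalc /evalmx mevalD.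
- by apply: polyfun_ext (polyfun_mul pf pg) => s; rewrite /evalc /evalmx mevalM.
Qed.

Lemma det_mx2 (A : 'M[F]_2) : \det A = A 0 0 * A 1 1 - A 0 1 * A 1 0.
Proof.
rewrite (expand_det_row _ 0) !big_ord_recl big_ord0 /cofactor !det_mx11 !mxE.
(* Reading the entries at natural numbers lets the lifted indices of the cofactors compute. *)
pose B (i j : nat) := A (inord i) (inord j).
have E i j : A i j = B i j by rewrite /B !inord_val.
by rewrite !E /= /bump /=; ring.
Qed.

Lemma det_cols3 (A : 'M[F]_3) : \det A = det3 (A 0 0, A 1 0, A (1 + 1) 0)
  (A 0 1, A 1 1, A (1 + 1) 1) (A 0 (1 + 1), A 1 (1 + 1), A (1 + 1) (1 + 1)).
Proof.
rewrite (expand_det_row _ 0) !big_ord_recl big_ord0 /cofactor !det_mx2 !mxE.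
pose B (i j : nat) := A (inord i) (inord j).
have E i j : A i j = B i j by rewrite /B !inord_val.
rewrite !E /= /bump /=; vring.
Qed.

Lemma evalc_bracket i j k s : evalc (bracket F i j k) s = det3 (s i) (s j) (s k).
Proof.
rewrite /evalc /bracket /evalmx -det_map_mx det_cols3 !mxE /= !mevalXU !mxvecE !mxE /vcoord /=.
by case: (s i) (s j) (s k) => [[? ?] ?] [[? ?] ?] [[? ?] ?].
Qed.

Lemma evalc_subst f (Y : 'M[poly]_(3, d)) s :
  evalc (substmx f Y) s = evalmx f (map_mx (fun f => evalmx f (mx_of s)) Y).
Proof.
rewrite /evalc /substmx /evalmx comp_mpoly_meval; apply: meval_eq => k.
by rewrite tnth_mktuple -map_mxvec mxE.
Qed.

Definition upd (s : 'I_d -> vec) (x : 'I_d) (v : vec) (j : 'I_d) : vec :=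
  if j == x then v else s j.

Definition meet (s : 'I_d -> vec) (p1 p2 p3 p4 : 'I_d) : vec :=
  cross (cross (s p3) (s p4)) (cross (s p1) (s p2)).

(** The Grassmann-Cayley vector is the expanded double cross product [meet], so the substitution
    amounts to evaluation at a configuration with column [x] moved. *)
Lemma evalc_replace f x p1 p2 p3 p4 s :
  evalc (substmx f (replace_col x (gc_vector F p1 p2 p3 p4))) s =
  evalc f (upd s x (meet s p1 p2 p3 p4)).
Proof.
rewrite evalc_subst /evalc; congr evalmx; apply/matrixP => i j.
rewrite !mxE /upd; case: ifP => _; last by rewrite /evalmx mevalXU mxvecE mxE.
rewrite /evalmx mevalB !mevalM !mevalXU !mxvecE !mxE.
have eb a b c : meval (fun k => mxvec (mx_of s) 0 k) (bracket F a b c) = det3 (s a) (s b) (s c).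
  exact: evalc_bracket.
rewrite !eb /meet.
by rewrite /vcoord; case: (ord3 i) => -> /=; vring.
Qed.

End Coordinates.

(** * Realizations as matrices *)

Section Realizations.
Variables (F : closedFieldType).
Local Notation vec := (vec F).
Local Notation vzero := (vzero F).
Implicit Types (u v w : 'cV[F]_3).

Definition colv (u : 'cV[F]_3) : vec := (u 0 0, u 1 0, u (1 + 1) 0).

Lemma colvD u v : colv (u + v) = vadd (colv u) (colv v).
Proof. by rewrite /colv !mxE. Qed.

Lemma colvZ a u : colv (a *: u) = vscale a (colv u).
Proof. by rewrite /colv !mxE. Qed.

Lemma colv0 : colv 0 = vzero.
Proof. by rewrite /colv !mxE. Qed.

Lemma colv_inj : injective colv.
Proof.
move=> u v [e0 e1 e2]; apply/matrixP => i j; rewrite ord1.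
by case: (ord3 i) => ->.
Qed.

Lemma colv_col d (g : 'M[F]_(3, d)) j : colv (col j g) = cols g j.
Proof. by rewrite /colv /cols !mxE. Qed.

Lemma free1 u : free [:: u] -> colv u <> vzero.
Proof. by rewrite seq1_free => /eqP u0 e; apply/u0/colv_inj; rewrite colv0. Qed.

Lemma free1_colv u : colv u <> vzero -> free [:: u].
Proof. by rewrite seq1_free => u0; apply/eqP => e; apply: u0; rewrite e colv0. Qed.

Lemma free2_cross u v : cross (colv u) (colv v) <> vzero -> free [:: u; v].
Proof.
move=> uv; apply/(@freeP _ _ 2 [tuple u; v]) => k.
rewrite !big_ord_recl big_ord0 addr0 /= => /(congr1 colv).
rewrite colvD !colvZ colv0 => e.
have e1 : k ord0 = 0.
  apply: (vscale_eq0 _ uv); rewrite -crossZl.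
  have := congr1 (fun x => cross x (colv v)) e; rewrite cross0v => <-; vring.
have e2 : k (lift ord0 ord0) = 0.
  apply: (vscale_eq0 _ uv); rewrite -crossZr.
  have := congr1 (fun x => cross (colv u) x) e; rewrite crossv0 => <-; vring.
by move=> i; case: (unliftP ord0 i) => [j ->|->]; rewrite ?ord1.
Qed.

Lemma free3_det u v w : det3 (colv u) (colv v) (colv w) <> 0 -> free [:: u; v; w].
Proof.
move=> /eqP uvw; apply/(@freeP _ _ 3 [tuple u; v; w]) => k.
rewrite !big_ord_recl big_ord0 addr0 /= => /(congr1 colv).
rewrite !colvD !colvZ colv0 => e.
have key a : a * det3 (colv u) (colv v) (colv w) = 0 -> a = 0.
  by move=> /eqP; rewrite mulf_eq0 (negbTE uvw) orbF => /eqP.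
have e1 : k ord0 = 0.
  apply: key; have := congr1 (fun x => det3 x (colv v) (colv w)) e.
  by rewrite /det3 cross0v dot0v => <-; vring.
have e2 : k (lift ord0 ord0) = 0.
  apply: key; have := congr1 (fun x => det3 (colv u) x (colv w)) e.
  by rewrite /det3 crossv0 dot0v => <-; vring.
have e3 : k (lift ord0 (lift ord0 ord0)) = 0.
  apply: key; have := congr1 (fun x => det3 (colv u) (colv v) x) e.
  by rewrite /det3 dotv0 => <-; vring.
move=> i; case: (unliftP ord0 i) => [j ->|-> //].
by case: (unliftP ord0 j) => [j' ->|-> //]; rewrite ord1.
Qed.

Lemma nfree3_det u v w : cross (colv u) (colv v) <> vzero ->
  det3 (colv u) (colv v) (colv w) = 0 -> ~~ free [:: u; v; w].
Proof.
move=> uv /(det3_span uv)[a [b ew]]; apply/negP => /(@freeP _ _ 3 [tuple u; v; w]).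
move=> /(_ (fun i => if val i == 0%N then a else if val i == 1%N then b else -1)) h.
suff /h /(_ ord_max) /eqP : \sum_(i < 3) (if val i == 0%N then a else
    if val i == 1%N then b else -1) *: [tuple u; v; w]`_i = 0.
  by rewrite /= oppr_eq0 oner_eq0.
apply: colv_inj; rewrite !big_ord_recl big_ord0 addr0 /= !colvD !colvZ colv0 ew; vring.
Qed.

Lemma nfree_size (X : seq 'cV[F]_3) : (3 < size X)%N -> ~~ free X.
Proof.
move=> sX; rewrite /free neq_ltn; apply/orP; left; apply: leq_ltn_trans sX.
by apply: leq_trans (dimvS (subvf _)) _; rewrite dimvf /dim /= muln1.
Qed.

Variables (d : nat) (M : matroid 'I_d).
Hypothesis plM : point_line M.

Lemma realization_weak (g : 'M[F]_(3, d)) : realization M g -> weakly_realizes (lines M) (cols g).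
Proof.
move=> rg x y z cxyz; have [->|/eqP xy] := eqVneq x y; first by rewrite det3_12.
have [->|/eqP yz] := eqVneq y z; first by rewrite det3_23.
have [->|/eqP xz] := eqVneq x z; first by rewrite det3_13.
have /rg := (dependent_collinear3 plM xy yz xz).2 cxyz.
apply: contraNeq => /eqP; rewrite -!colv_col => d0.
have fr : free ([seq col i g | i <- [:: x; y; z]]) by apply: free3_det.
rewrite (perm_free (Y := [seq col i g | i <- [:: x; y; z]])) //; apply: perm_map.
apply: uniq_perm; rewrite ?enum_uniq //=.
  by rewrite !inE !andbT negb_or; do ![apply/andP; split]; apply/eqP.
by move=> w; rewrite mem_enum !inE orbA.
Qed.

Lemma realization_nonzero (g : 'M[F]_(3, d)) : realization M g -> nonzero (cols g).
Proof.
move=> rg x; rewrite -colv_col; apply: free1; apply/negPn/negP => nf.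
have /rg : ~~ free [seq col i g | i <- enum [set x]] by rewrite enum_set1.
by rewrite /dependent indep_le2 // cards1.
Qed.

(** By cardinality: sets of size at most two are independent on both sides, triples are read off
    determinants, and larger sets are dependent on both sides for reasons of rank and dimension. *)
Lemma real_realization s : nonzero s -> realizes (lines M) s -> realization M (mx_of s : 'M[F]_(3, d)).
Proof.
move=> ns [r2 r3] A; set g := mx_of s.
have cs j : colv (col j g) = s j by rewrite colv_col cols_mx.
have cA := cardE A; case e : (enum A) cA => [|a [|b [|c [|t r]]]] /= cA.
- by rewrite /dependent indep_le2 ?cA // nil_free.
- by rewrite /dependent indep_le2 ?cA // free1_colv // cs.
- have ab : a <> b by have := enum_uniq A; rewrite e /= inE andbT => /eqP.
  by rewrite /dependent indep_le2 ?cA // free2_cross // !cs; apply: r2.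
- have := enum_uniq A; rewrite e /= !inE !andbT negb_or => /andP[/andP[/eqP ab /eqP ac] /eqP bc].
  have -> : A = [set a; b; c].
    by apply/setP => w; rewrite -mem_enum e !inE orbA.
  rewrite (dependent_collinear3 plM ab bc ac) -(r3 a b c ab bc ac); split=> [d0|].
    by apply: nfree3_det; rewrite !cs //; apply: r2.
  by apply: contraNeq => /eqP d0; apply: free3_det; rewrite !cs.
- split=> _; first by apply: nfree_size.
  by apply/negP => /(indep_card plM); rewrite cA.
Qed.

End Realizations.

(** * Zeros of the Grassmann-Cayley polynomials and the two inclusions *)

Section Main.
Variables (F : closedFieldType) (d : nat) (M : matroid 'I_d).
Local Notation vec := (vec F).
Local Notation vzero := (vzero F).
Local Notation poly := {mpoly F[3 * d]}.
Hypothesis plM : point_line M.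

Definition gc_zero (s : 'I_d -> vec) : Prop :=
  forall j (f : poly), gc_set M j f -> evalc f s = 0.

Lemma circuit_bracketsP (f : poly) : circuit_brackets M f <-> exists x y z,
  [/\ x <> y, y <> z, x <> z, collinear3 (lines M) x y z & f = bracket F x y z].
Proof.
split=> [[x [y [z [c3 cM ->]]]]|[x [y [z [xy yz xz cxyz ->]]]]]; exists x, y, z; split=> //.
- by have [] := card3_distinct c3.
- by have [] := card3_distinct c3.
- by have [] := card3_distinct c3.
- have [xy yz xz] := card3_distinct c3.
  by apply/(dependent_collinear3 plM xy yz xz); have := minsetp cM.
- exact: card3.
- by apply: dependent3_circuit; rewrite ?card3 //; apply/(dependent_collinear3 plM xy yz xz).
Qed.

Lemma gc_zero_weak s : gc_zero s -> weakly_realizes (lines M) s.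
Proof.
move=> gs x y z cxyz; have [->|/eqP xy] := eqVneq x y; first by rewrite det3_12.
have [->|/eqP yz] := eqVneq y z; first by rewrite det3_23.
have [->|/eqP xz] := eqVneq x z; first by rewrite det3_13.
rewrite -evalc_bracket; apply: (gs 0%N); apply/circuit_bracketsP.
by exists x, y, z.
Qed.

(* The substitution that defines [gc_step] maps [gc_set j] to [gc_set j.+1]. *)
Lemma gc_zero_upd s x l1 l2 p1 p2 p3 p4 : gc_zero s ->
  l1 \in lines M -> l2 \in lines M -> l1 != l2 -> x \in l1 -> x \in l2 ->
  p1 \in l1 -> p2 \in l1 -> p3 \in l2 -> p4 \in l2 ->
  gc_zero (upd s x (meet s p1 p2 p3 p4)).
Proof.
move=> gs lM1 lM2 l12 x1 x2 pl1 pl2 pl3 pl4 j f fj.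
rewrite -evalc_replace; apply: (gs j.+1); right.
exists f, x, l1, l2, p1, p2, p3, p4; split=> //.
by split; rewrite // /lines_at in_set ?lM1 ?lM2 ?x1 ?x2.
Qed.

(** The planes of both lines contain [r x], so their meet is zero or proportional to [r x], and the
    substitution only changes the scalar at [x]. Quantifying over all scalings lets the induction
    absorb this change. *)
Lemma gc_zero_scaled (c : 'I_d -> F) (r : 'I_d -> vec) :
  weakly_realizes (lines M) r -> nonzero r -> gc_zero (fun x => vscale (c x) (r x)).
Proof.
move=> wr nr j; elim: j c => [|j IH] c f.
  by move=> /circuit_bracketsP[x [y [z [_ _ _ cxyz ->]]]]; rewrite evalc_bracket det3Z wr ?mulr0.
case=> [/IH //|[P [x [l1 [l2 [p1 [p2 [p3 [p4 [PX [l1x l2x _] [pl1 pl2] [pl3 pl4] ->]]]]]]]]]].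
rewrite evalc_replace; set s := fun x => _.
have perp l q q' : l \in lines_at M x -> q \in l -> q' \in l ->
    dot (cross (s q) (s q')) (r x) = 0.
  rewrite /lines_at in_set => /andP[lM xl] ql q'l; rewrite -/(det3 _ _ _) -[r x]vscale1 det3Z.
  by rewrite wr ?mulr0 //; exists l.
have [a ea] : exists a, meet s p1 p2 p3 p4 = vscale a (r x).
  have [e|m0] := boolp.pselect (meet s p1 p2 p3 p4 = vzero).
    by exists 0; rewrite e vscale0.
  have [b eb] := perp2 m0 (perp _ _ _ l2x pl3 pl4) (perp _ _ _ l1x pl1 pl2).
  have b0 : b != 0 by apply/eqP => b0; apply: (nr x); rewrite eb b0 vscale0.
  by exists b^-1; rewrite eb vscaleA mulVf // vscale1.
rewrite ea (_ : upd s x _ = fun y => vscale (if y == x then a else c y) (r y)); first exact: IH.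
by apply: boolp.funext => y; rewrite /upd; case: eqVneq => [->|].
Qed.

(** Each replacement fills a zero column with a nonzero meet and leaves the others alone, so the
    number of zero columns decreases. *)
Lemma gc_zero_terminal s : gc_zero s -> exists s',
  [/\ gc_zero s', forall x, s x = vzero \/ s' x = s x &
    forall x l1 l2 p1 p2 p3 p4, s' x = vzero -> l1 \in lines M -> l2 \in lines M ->
      l1 != l2 -> x \in l1 -> x \in l2 -> p1 \in l1 -> p2 \in l1 -> p3 \in l2 -> p4 \in l2 ->
      cross (cross (s' p1) (s' p2)) (cross (s' p3) (s' p4)) = vzero].
Proof.
have [n] := ubnP #|[set x | s x == vzero]|; elim: n s => // n IH s.
rewrite ltnS => szn gs; apply: boolp.contrapT => hn.
have term : forall x l1 l2 p1 p2 p3 p4, s x = vzero -> l1 \in lines M -> l2 \in lines M ->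
      l1 != l2 -> x \in l1 -> x \in l2 -> p1 \in l1 -> p2 \in l1 -> p3 \in l2 -> p4 \in l2 ->
      cross (cross (s p1) (s p2)) (cross (s p3) (s p4)) = vzero.
  move=> x l1 l2 p1 p2 p3 p4 sx lM1 lM2 l12 x1 x2 pl1 pl2 pl3 pl4.
  apply: boolp.contrapT => /cross_neq0C; rewrite -/(meet s p1 p2 p3 p4) => m0.
  have g' := gc_zero_upd gs lM1 lM2 l12 x1 x2 pl1 pl2 pl3 pl4.
  have [|s' [gs' ss' t']] := IH _ _ g'.
    apply: leq_trans szn; apply: proper_card; apply/properP; split.
      apply/subsetP => y; rewrite !inE /upd; case: (eqVneq y x) => [->|//].
      by rewrite sx.
    by exists x; rewrite !inE ?sx // /upd eqxx; apply/eqP.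
  apply: hn; exists s'; split=> // y; have [->|yx] := eqVneq y x; first by left.
  by have := ss' y; rewrite /upd (negbTE yx).
by apply: hn; exists s; split=> // x; right.
Qed.

Hypothesis cM : cactus M.
Hypothesis ncM : ~ contains_cycle M (Qpoints M).

Lemma gc_zero_closure s : gc_zero s -> cl (realizes (lines M)) s.
Proof.
move=> gs; have [s' [gs' ss' term]] := gc_zero_terminal gs.
have [|u [wu nu su]] := nonzero_completion (gc_zero_weak gs') _ term.
  by move=> /(has_cycle_contains plM).
apply: (@cl_trans _ _ (fun t => weakly_realizes (lines M) t /\ nonzero t)); last first.
  by move=> t [wt nt]; apply: closable_cactus.
pose phi (t : 'I_d -> vec) x := vscale (vc1 (t x)) (u x).
(* Where [s] is nonzero, the replacements and the completion have left it unchanged, so scalars 0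
   and 1 recover [s] from [u]. *)
pose t0 x := if s x == vzero then vzero else ve1 F.
have -> : s = phi t0.
  apply: boolp.funext => x; rewrite /phi /t0; case: eqVneq => [->|/eqP s0].
    by rewrite vscale0.
  rewrite vscale1; case: (ss' x) => // e; case: (su x) => [e'|->//].
  by case: s0; rewrite -e.
apply: cl_generic => [x|].
  by apply: polyvec_scale; [constructor | apply: polyvec_const].
have g0 : generic (fun t => forall x, phi t x <> vzero).
  apply: generic_all => x; apply: (@generic_vec _ _ _ (fun=> ve1 F)).
    by apply: polyvec_scale; [constructor | apply: polyvec_const].
  by rewrite /phi vscale1.
apply: generic_mono g0 => t nt; split=> // x y z cxyz.
by rewrite /phi det3Z wu ?mulr0.
Qed.

Lemma real_nonzero (s : 'I_d -> vec) : realizes (lines M) s -> nonzero s.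
Proof.
move=> [r2 _] x; have [_ cc] := cM.
have xA : x \in component M x by rewrite inE connect0.
have [[y yA] xy] := connected_cactus_partner (Sub x xA) (cc x).
apply: (@cross_neq0l _ _ (s y)); apply: r2 => e; apply: xy; exact/val_inj.
Qed.

Let ideal : poly -> Prop := ideal_add (circuit_ideal M) (grassmann_cayley_ideal M).

Lemma ideal_gen_ideal (A : comNzRingType) (S : A -> Prop) : is_ideal (ideal_gen S).
Proof.
split.
- by exists 0%N, (fun=> 0), (fun=> 0); split=> [[]|] //; rewrite big_ord0.
- move=> x y [n [a [s [Ss ->]]]] [m [b [t [St ->]]]].
  exists (n + m)%N, (fun i => match split i with inl j => a j | inr j => b j end),
    (fun i => match split i with inl j => s j | inr j => t j end); split.
    by move=> i; case: split.
  rewrite big_split_ord /=; congr (_ + _); apply: eq_bigr => i _.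
    by rewrite (unsplitK (inl i)).
  by rewrite (unsplitK (inr i)).
- move=> c x [n [a [s [Ss ->]]]]; exists n, (fun i => c * a i), s; split=> //.
  by rewrite mulr_sumr; apply: eq_bigr => i _; rewrite mulrA.
Qed.

Lemma ideal_gen_mem (A : comNzRingType) (S : A -> Prop) f : S f -> ideal_gen S f.
Proof.
move=> Sf; exists 1%N, (fun=> 1), (fun=> f); split=> //.
by rewrite big_ord_recl big_ord0 mul1r addr0.
Qed.

Lemma gc_set_leq j j' (f : poly) : (j <= j')%N -> gc_set M j f -> gc_set M j' f.
Proof.
move=> /subnK <-; elim: (j' - j)%N => // n IH fj; rewrite addSn; left; exact: IH.
Qed.

Lemma gc_ideal_ideal : is_ideal (grassmann_cayley_ideal M : poly -> Prop).
Proof.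
split.
- by exists 0%N => j _; case: (ideal_gen_ideal (gc_set M j : poly -> Prop)).
- move=> x y [i hi] [j hj]; exists (maxn i j) => k; rewrite geq_max => /andP[ik jk].
  case: (ideal_gen_ideal (gc_set M k : poly -> Prop)) => _ gD _.
  by apply: gD; [apply: hi | apply: hj].
- move=> a x [i hi]; exists i => k ik.
  by case: (ideal_gen_ideal (gc_set M k : poly -> Prop)) => _ _; apply; apply: hi.
Qed.

Lemma ideal_is_ideal : is_ideal ideal.
Proof.
have [c0 cD cM'] := ideal_gen_ideal (circuit_brackets M : poly -> Prop).
have [g0 gD gM] := gc_ideal_ideal.
split.
- by exists 0, 0; rewrite addr0.
- move=> x y [a [b [ca gb ->]]] [a' [b' [ca' gb' ->]]]; exists (a + a'), (b + b').
  by split; [exact: cD | exact: gD | rewrite addrACA].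
- move=> x y [a [b [ca gb ->]]]; exists (x * a), (x * b).
  by split; [exact: cM' | exact: gM | rewrite mulrDr].
Qed.

Lemma gc_set_ideal j (f : poly) : gc_set M j f -> ideal f.
Proof.
move=> fj; exists 0, f; split; last by rewrite add0r.
  by case: (ideal_gen_ideal (circuit_brackets M : poly -> Prop)).
by exists j => k jk; apply/ideal_gen_mem/(gc_set_leq jk).
Qed.

Lemma ideal_eval s (f : poly) : gc_zero s -> ideal f -> evalc f s = 0.
Proof.
move=> gs [a [b [ca [j hj] ->]]]; rewrite /evalc /evalmx mevalD -!/(evalmx _ _) -!/(evalc _ _).
have gen k (h : poly) : ideal_gen (gc_set M k) h -> evalc h s = 0.
  move=> [n [u [v [vk ->]]]]; rewrite /evalc /evalmx raddf_sum /= big1 // => i _.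
  have := gs k _ (vk i); rewrite /evalc /evalmx => e.
  by rewrite mevalM e mulr0.
by rewrite (gen 0%N) // (gen j) ?addr0 //; apply: hj.
Qed.

Lemma matroid_ideal_real (f : poly) s :
  matroid_ideal M f -> realizes (lines M) s -> evalc f s = 0.
Proof.
move=> fI rs; apply: fI => S HS.
by apply: HS; apply: real_realization => //; apply: real_nonzero.
Qed.

Lemma matroid_idealP (f : poly) : matroid_ideal M f <-> radical ideal f.
Proof.
split=> [fI|[n In] g Vg].
  apply: nullstellensatz; first exact: ideal_is_ideal.
  move=> v vI; pose s := cols (vec_mx (\row_k v k)).
  have ev (h : poly) : evalc h s = h.@[v].
    rewrite /evalc /s mx_cols /evalmx; apply: meval_eq => k.
    by rewrite vec_mxK mxE.
  rewrite -ev; apply: gc_zero_closure (polyfun_evalc f) _ => [j h /gc_set_ideal /vI|t].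
    by rewrite ev.
  exact: matroid_ideal_real.
(* The Zariski closure is tested on the single equation [f]. *)
apply: (Vg (eq f)) => // h rh _ <-.
have gs : gc_zero (cols h).
  have := gc_zero_scaled (fun=> 1) (realization_weak plM rh) (realization_nonzero plM rh).
  by congr gc_zero; apply: boolp.funext => x; rewrite vscale1.
have := ideal_eval gs In; rewrite /evalc mx_cols /evalmx rmorphXn /= => /eqP.
by rewrite expf_eq0 => /andP[_ /eqP].
Qed.

End Main.

Local Close Scope ring_scope.

Theorem theorem3p15 (R : realType) (d : nat) (M : matroid 'I_d) :
  cactus M ->
  ~ contains_cycle M (Qpoints M) ->
  forall f : {mpoly R[i][3 * d]},
    matroid_ideal M f <->
    radical (ideal_add (circuit_ideal M) (grassmann_cayley_ideal M)) f.
Proof.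
move=> cM ncM f; have [plM _] := cM.
exact: (@matroid_idealP _ d M plM cM ncM f).
Qed.
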